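(* Let $(P_n)_{n=0}^\infty$ be a fixed family of real-valued Sheffer polynomials and let $\tau=(\tau_n)_{n=0}^\infty\in\mathbb{C}^\infty$. (Necessity) If $\tau$ is an analytic moment functional on $(l_{\mathrm{fin}},\ast_P)$, then $\tau$ is $\ast_P$-positive (i.e. $\tau(f\ast_P\bar f)\ge 0$ for all $f\in l_{\mathrm{fin}}$) and $\tau\in l^2_-$. (Sufficiency) If $\tau$ is $\ast_P$-positive and there is a constant $C>0$ such that $$\tau(\delta_n\ast_P\delta_n)=\sum_{k=0}^{2n}\tau_k(\delta_n\ast_P\delta_n)_k\le (n!)^2C^{n+1},\quad n\in\mathbb{N}_0,$$ then $\tau$ is an analytic moment functional on $(l_{\mathrm{fin}},\ast_P)$.
   Context: $\mathbb{N}_0=\{0,1,2,\dots\}$. $\mathbb{C}^\infty$ is the space of all complex sequences, $l_{\mathrm{fin}}$ its subspace of finitely supported sequences; $\tau\in\mathbb{C}^\infty$ acts on $l_{\mathrm{fin}}$ by $\tau(f)=\sum_n\tau_nf_n$; $\bar f=(\bar f_n)_n$; $\delta_n=(\delta_{nj})_{j=0}^\infty$ is the $n$-th unit sequence. Sheffer polynomials: a family $(P_n)_{n=0}^\infty$ with generating function $\gamma(\lambda)e^{\alpha(\lambda)x}=\sum_{n=0}^\infty\frac{\lambda^n}{n!}P_n(x)$ for $x\in\mathbb{R}$ and $\lambda$ in a neighborhood $\mathcal{U}$ of $0\in\mathbb{C}$, where $\gamma,\alpha$ are analytic in $\mathcal{U}$, $\alpha(0)=0$, $\alpha'(0)\ne0$,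 $\gamma(0)=1$; then $\deg P_n=n$. Product: $f\ast_Pg:=I_P^{-1}(I_Pf\cdot I_Pg)$, where $I_P:l_{\mathrm{fin}}\to\mathbb{C}[x]$ is the linear bijection $(I_Pf)(x)=\sum_nf_nP_n(x)$. $l^2_-$ is the set of $\xi\in\mathbb{C}^\infty$ for which there is $q\in\mathbb{N}$ with $\sum_{n=0}^\infty|\xi_n|^2(n!)^{-2}2^{-qn}<\infty$. $\mathcal{M}_a(\mathbb{R})$ is the set of non-negative finite Borel measures $\mu$ on $\mathbb{R}$ (analytic measures) whose Laplace transform $l_\mu(\lambda)=\int_{\mathbb{R}}e^{x\lambda}\,d\mu(x)$ is well-defined in a neighborhood of $0\in\mathbb{C}$ and holomorphic at $0$. $\tau$ is an analytic moment functional on $(l_{\mathrm{fin}},\ast_P)$ if there is $\mu\in\mathcal{M}_a(\mathbb{R})$ with $\tau_n=\int_{\mathbb{R}}P_n(x)\,d\mu(x)$ for all $n\in\mathbb{N}_0$. *)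

(* Defs.v *)
From HB Require Import structures.
From mathcomp Require Export all_boot all_order all_algebra finmap.
From mathcomp Require Export all_classical all_reals all_analysis.
From mathcomp Require Export complex.
From mathcomp Require Import zify.

Set Implicit Arguments.
Unset Strict Implicit.
Unset Printing Implicit Defensive.

Import Order.TTheory GRing.Theory Num.Theory.
Export numFieldNormedType.Exports.

Local Open Scope fset_scope.
Local Open Scope classical_set_scope.
Local Open Scope complex_scope.
Local Open Scope ring_scope.

(* Real-closed's [R[i]] carries no topology of its own. It gets the one that
   every [numFieldType] has through its modulus, so that limits, [derivable]
   and ['D_1] on [R[i]] are the complex ones. *)
#[export, non_forgetful_inheritance]
HB.instance Definition _ (R : rcfType) := NormedModule.copy R[i] R[i]^o.

Section ComplexAnalysis.
Variable R : realType.
Implicit Types (f : R[i] -> R[i]) (z : R[i]).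

Definition cexp z : R[i] :=
  (expR (complex.Re z) * cos (complex.Im z)) +i*
  (expR (complex.Re z) * sin (complex.Im z)).

Definition analytic_at f z0 : Prop :=
  exists a : nat -> R[i],
    \forall z \near z0, series (fun n => a n * (z - z0) ^+ n) @ \oo --> f z.

Definition holomorphic_at f z0 : Prop :=
  \forall z \near z0, derivable f z 1.

End ComplexAnalysis.

Section ComplexIntegral.
Context d (T : measurableType d) (R : realType).
Variable mu : {measure set T -> \bar R}.
Implicit Type f : T -> R[i].

Definition cintegrable f : Prop :=
  mu.-integrable setT (fun x => (complex.Re (f x))%:E) /\
  mu.-integrable setT (fun x => (complex.Im (f x))%:E).

(* Junk value if [f] is not integrable. *)
Definition cintegral f : R[i] :=
  (\int[mu]_x complex.Re (f x)) +i* (\int[mu]_x complex.Im (f x)).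

End ComplexIntegral.

Section Sheffer.
Variable R : realType.
Local Notation C := R[i].
Implicit Types (P : nat -> {poly C}) (tau xi : nat -> C).

Definition sheffer P : Prop :=
  exists (gamma alpha : C -> C) (U : set C),
    [/\ nbhs (0 : C) U,
        forall z, U z -> analytic_at gamma z /\ analytic_at alpha z,
        [/\ alpha 0 = 0, 'D_1 alpha 0 != 0 & gamma 0 = 1]
      & forall (x : R) (z : C), U z ->
          series (fun n => z ^+ n / n`!%:R * (P n).[x%:C]) @ \oo -->
            gamma z * cexp (alpha z * x%:C)].

Definition real_valued (p : {poly C}) : Prop :=
  forall x : R, p.[x%:C] \is Num.real.

Definition lfin := {fsfun nat -> C with 0}.

Definition delta (n : nat) : lfin := [fsfun j in [fset n] => 1 | 0].

Definition conj_lfin (f : lfin) : lfin :=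
  [fsfun n in finsupp f => conjc (f n) | 0].

Definition dual tau (f : lfin) : C := \sum_(n <- finsupp f) tau n * f n.

Definition IP P (f : lfin) : {poly C} := \sum_(n <- finsupp f) f n *: P n.

(* [IP P] is a bijection as soon as [deg (P n) = n] for all [n], which holds for
   Sheffer polynomials; ['pinv_] is then its inverse (see [IP_bij], [starE]). *)
Definition star P (f g : lfin) : lfin :=
  'pinv_(fun=> [fsfun]) setT (IP P) (IP P f * IP P g).

Definition star_positive P tau : Prop :=
  forall f : lfin, 0 <= dual tau (star P f (conj_lfin f)).

Definition l2minus : set (nat -> C) :=
  [set xi | exists q : nat,
    (\sum_(0 <= n <oo)
       (ComplexField.Normc.normc (xi n) ^+ 2 * (n`!%:R ^- 2) * 2 ^- (q * n))%:E
     < +oo)%E].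

Definition laplace (mu : {measure set (measurableTypeR R) -> \bar R}) (z : C) :
    C :=
  cintegral mu (fun x : R => cexp (x%:C * z)).

Definition analytic_measure
    (mu : {finite_measure set (measurableTypeR R) -> \bar R}) : Prop :=
  (\forall z \near (0 : C), cintegrable mu (fun x : R => cexp (x%:C * z))) /\
  holomorphic_at (laplace mu) 0.

Definition analytic_moment_functional P tau : Prop :=
  exists2 mu : {finite_measure set (measurableTypeR R) -> \bar R},
    analytic_measure mu &
    forall n, cintegrable mu (fun x : R => (P n).[x%:C]) /\
      tau n = cintegral mu (fun x : R => (P n).[x%:C]).

Section Bijectivity.
Variables (P : nat -> {poly C}) (sP : forall n, size (P n) = n.+1).

Let lP n : (P n)`_n != 0.
Proof.
have := lead_coefE (P n); rewrite sP /= => <-.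
by rewrite lead_coef_eq0 -size_poly_gt0 sP.
Qed.

Let size_sumP (a : nat -> C) N : (size (\sum_(n < N) a n *: P n)%R <= N)%N.
Proof.
apply: (leq_trans (size_sum _ _ _)); apply/bigmax_leqP => -[n nN] _ /=.
by rewrite (leq_trans (size_scale_leq _ _)) // sP.
Qed.

Lemma lfin_sum (V : lmodType C) (f : lfin) (v : nat -> V) N :
  (forall n, (N <= n)%N -> f n = 0) ->
  \sum_(n <- finsupp f) f n *: v n = \sum_(n < N) f n *: v n.
Proof.
move=> f0; rewrite -(big_mkord xpredT (fun n => f n *: v n)).
rewrite [RHS](bigID (mem (finsupp f))) /=.
rewrite [X in _ = _ + X]big1 ?addr0; last first.
  by move=> n; rewrite memNfinsupp => /eqP ->; rewrite scale0r.
rewrite -[RHS]big_filter; apply: perm_big; apply: uniq_perm.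
- exact: fset_uniq.
- by rewrite filter_uniq // iota_uniq.
move=> n; rewrite mem_filter mem_index_iota /=.
have [nf/=|//] := boolP (n \in finsupp f).
by rewrite ltnNge; apply/esym/negP => /f0 fn; rewrite mem_finsupp fn eqxx in nf.
Qed.

Lemma lfin_bounded (f : lfin) :
  exists N, forall M, (N <= M)%N -> forall n, (M <= n)%N -> f n = 0.
Proof.
exists (\max_(n <- finsupp f) n).+1 => M NM n Mn; apply/eqP.
rewrite -memNfinsupp; apply/negP => nf.
have := leq_trans NM Mn; rewrite ltnNge => /negP; apply.
exact: leq_bigmax_seq.
Qed.

Lemma IP_onto N (p : {poly C}) : (size p <= N)%N ->
  exists2 f : lfin, IP P f = p & forall n, (N <= n)%N -> f n = 0.
Proof.
move=> pN; suff [a pa] : exists a : nat -> C, p = \sum_(n < N) a n *: P n.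
  pose f : lfin := [fsfun n in [fset k in iota 0 N] => a n | 0].
  have fE n : f n = if (n < N)%N then a n else 0.
    by rewrite fsfun_fun !inE mem_iota add0n.
  have f0 n : (N <= n)%N -> f n = 0 by move=> Nn; rewrite fE ltnNge Nn.
  exists f => //; rewrite /IP (lfin_sum _ f0) pa.
  by apply: eq_bigr => -[n nN] _ /=; rewrite fE nN.
elim: N p pN => [|N IH] p pN.
  by exists (fun=> 0); rewrite big_ord0; apply/eqP; rewrite -size_poly_leq0.
pose c := p`_N / (P N)`_N.
have /IH[a pa] : (size (p - c *: P N)%R <= N)%N.
  apply/leq_sizeP => j; rewrite leq_eqVlt => /orP[/eqP <-|Nj].
    by rewrite coefB coefZ divfK ?subrr.
  rewrite coefB coefZ (leq_sizeP _ _ pN)// [(P N)`_j]nth_default ?sP//.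
  by rewrite mulr0 subrr.
exists (fun n => if (n < N)%N then a n else c).
rewrite big_ord_recr /= ltnn -[LHS](subrK (c *: P N)) pa; congr (_ + _).
by apply: eq_bigr => -[n nN] _ /=; rewrite nN.
Qed.

Lemma IP_inj : injective (IP P).
Proof.
move=> f g fg; apply/fsfunP => k.
have [Nf fN] := lfin_bounded f; have [Ng gN] := lfin_bounded g.
pose N := maxn (maxn Nf Ng) k.+1.
have fN0 n : (N <= n)%N -> f n = 0 by apply: fN; rewrite /N; lia.
have gN0 n : (N <= n)%N -> g n = 0 by apply: gN; rewrite /N; lia.
have kN : (k < N)%N by rewrite /N; lia.
move: fg; rewrite /IP (lfin_sum _ fN0) (lfin_sum _ gN0) => /eqP.
rewrite -subr_eq0 -sumrB; move: kN; clearbody N; clear -lP size_sumP sP.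
elim: N => // N IH kN; rewrite big_ord_recr /= => /eqP S0.
have SE : \sum_(n < N) (f n *: P n - g n *: P n) =
          \sum_(n < N) (f n - g n) *: P n.
  by apply: eq_bigr => i _; rewrite scalerBl.
have fgN : f N = g N.
  have := congr1 (fun p : {poly C} => p`_N) S0.
  rewrite /= coefD SE nth_default; last exact: (size_sumP (fun i => f i - g i)).
  rewrite add0r -scalerBl coefZ coef0 => /eqP.
  by rewrite mulf_eq0 (negPf (lP N)) orbF subr_eq0 => /eqP.
move: kN; rewrite ltnS leq_eqVlt => /orP[/eqP ->//|/IH]; apply.
by move: S0; rewrite fgN subrr addr0 => ->.
Qed.

Lemma IP_bij : bijective (IP P).
Proof.
rewrite -setTT_bijective; split=> //; first by move=> f g _ _; exact: IP_inj.
by move=> p _; have [f fp _] := IP_onto (leqnn (size p)); exists f.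
Qed.

Lemma starE (f g : lfin) : IP P (star P f g) = IP P f * IP P g.
Proof.
rewrite /star pinvK// inE.
by have [h hp _] := IP_onto (leqnn (size (IP P f * IP P g))); exists h.
Qed.

Lemma IP_delta n : IP P (delta n) = P n.
Proof.
have d0 m : (n < m)%N -> delta n m = 0.
  by move=> nm; rewrite fsfun_fun !inE gtn_eqF.
rewrite /IP (lfin_sum _ d0) big_ord_recr big1 /= ?add0r.
  by rewrite fsfun_fun !inE eqxx scale1r.
by move=> [m mn] _ /=; rewrite fsfun_fun !inE ltn_eqF// scale0r.
Qed.

Lemma dual_star_delta tau n :
  dual tau (star P (delta n) (delta n)) =
  \sum_(k < (2 * n).+1) tau k * star P (delta n) (delta n) k.
Proof.
have dE (f : lfin) : dual tau f = \sum_(k <- finsupp f) f k *: (tau k : C^o).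
  by apply: eq_bigr => k _; rewrite mulrC.
have : (size (P n * P n)%R <= (2 * n).+1)%N.
  by rewrite (leq_trans (size_polyMleq _ _)) // sP; lia.
case/IP_onto => f fP f0.
have -> : star P (delta n) (delta n) = f.
  by apply: IP_inj; rewrite starE !IP_delta.
by rewrite dE (lfin_sum _ f0); apply: eq_bigr => k _; rewrite mulrC.
Qed.

End Bijectivity.
End Sheffer.

(* Main.v *)
(* For real t near 0 the functions gamma and alpha are real, and comparing
   asymptotic expansions at 0 in [sum_n t^n p_n(x) = gamma(t) exp(alpha(t) x)],
   [p_n = P_n / n!], gives [p_n' = sum_(j >= 1) a_j p_(n-j)] and [p_n(0) = g_n],
   where a_j and g_n are the Taylor coefficients of alpha and gamma.

   Necessity: the recursion bounds the k-th coefficient of p_n by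
   [M s^n e^k / k!] for any prescribed [e > 0], hence
   [|p_n(x)| <= M s^n exp(e |x|)], which is integrable for small e.

   Sufficiency: since [a_1 <> 0], the recursion also shows that integration from 0
   is bounded for a weighted l1 norm with respect to the basis (p_n), so that
   [x^n / n!] has norm at most K^n. Therefore the functional L induced by tau on
   real polynomials satisfies [L(x^(2n)) <= (M n! K^n)^2].
   L is nonnegative on nonnegative polynomials, which are sums of two squares, so
   by M. Riesz it extends to a positive functional on the functions dominated by
   polynomials; regularizing its values on the indicators of half-lines gives the
   distribution function of a representing measure. The moment bound makes
   [exp(r |x|)] integrable for some [r > 0], and the Laplace transform is then
   differentiable near 0 by domination. *)

Require Import Defs.
From HB Require Import structures.
From mathcomp Require Import all_boot all_order all_algebra finmap.
From mathcomp Require Import all_classical all_reals all_analysis complex.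
From mathcomp Require Import measurable_realfun ring lra zify.

Set Implicit Arguments.
Unset Strict Implicit.
Unset Printing Implicit Defensive.

Import Order.TTheory GRing.Theory Num.Theory.
Import numFieldNormedType.Exports.

Local Open Scope classical_set_scope.
Local Open Scope complex_scope.
Local Open Scope ring_scope.

(** * Asymptotic expansions at the origin *)

(** Under [IP P] the star product is polynomial multiplication, so positivity of [tau] only gives
    [L (q ^+ 2) >= 0], while the extension theorem needs [L] nonnegative on all nonnegative
    polynomials: hence the sums of squares. The growth hypothesis likewise only bounds [L] on
    squares of Sheffer polynomials; Cauchy-Schwarz makes the square root of [L (q ^+ 2)] a seminorm,
    which a weighted l1 norm with large weights dominates up to a constant.

    Comparing polynomials up to [O(t^N)] replaces products, compositions and termwise derivatives of
    power series by polynomial algebra.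

    The extension of [L] is only finitely additive, so its values on half-lines need not be right
    continuous; and after regularization it is no longer evident that the measure integrates
    polynomials to [L]. Each nonnegative [q] therefore gets its own distribution function, standing
    for the measure with density [q]. It agrees with the integral of [q] up to second order on short
    intervals, and Chebyshev's inequality with the value of [L] at [q * 'X ^+ 2] keeps mass from
    escaping to infinity. *)

Section Approx.
Variable R : realType.
Implicit Types (f g : R -> R) (q r : {poly R}) (N : nat).

(* Only one-sided limits at 0 are needed: power series are determined by their
   values on small positive reals. *)
Definition approx N f q : Prop :=
  exists2 K : R, 0 <= K & \forall t \near 0^'+, `|f t - q.[t]| <= K * t ^+ N.

Lemma horner_bounded q :
  exists2 K : R, 0 <= K & \forall t \near 0^'+, `|q.[t]| <= K.
Proof.
exists (\sum_(i < size q) `|q`_i|); first by apply: sumr_ge0.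
near=> t.
have t0 : 0 < t by near: t; exact: nbhs_right_gt.
have t1 : t <= 1 by near: t; exact: nbhs_right_le.
rewrite horner_coef (le_trans (ler_norm_sum _ _ _))// ler_sum// => i _.
by rewrite normrM ler_piMr// normrX gtr0_norm// exprn_ile1// ltW.
Unshelve. all: by end_near. Qed.

Lemma approx_near N f g q :
  (\forall t \near 0^'+, f t = g t) -> approx N f q -> approx N g q.
Proof.
move=> fg [K K0 fq]; exists K => //; near=> t.
have <- : f t = g t by near: t.
by near: t.
Unshelve. all: by end_near. Qed.

Lemma approx_cst N (c : R) : approx N (fun=> c) c%:P.
Proof.
exists 0 => //; near=> t; by rewrite hornerC subrr normr0 mul0r.
Unshelve. all: by end_near. Qed.

Lemma approxD N f g q r :
  approx N f q -> approx N g r -> approx N (fun t => f t + g t) (q + r).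
Proof.
move=> [K K0 fq] [L L0 gr]; exists (K + L); first exact: addr_ge0.
near=> t.
rewrite hornerD opprD addrACA (le_trans (ler_normD _ _))// mulrDl.
by apply: lerD; near: t.
Unshelve. all: by end_near. Qed.

Lemma approxM N f g q r :
  approx N f q -> approx N g r -> approx N (fun t => f t * g t) (q * r).
Proof.
move=> [K K0 fq] [L L0 gr].
have [Mq Mq0 qM] := horner_bounded q; have [Mr Mr0 rM] := horner_bounded r.
exists (K * (L + Mr) + Mq * L).
  by rewrite addr_ge0 ?mulr_ge0 ?addr_ge0.
near=> t.
have t0 : 0 < t by near: t; exact: nbhs_right_gt.
have t1 : t <= 1 by near: t; exact: nbhs_right_le.
have tN : t ^+ N <= 1 by rewrite exprn_ile1// ltW.
have tN0 : 0 <= t ^+ N by rewrite exprn_ge0// ltW.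
have hf : `|f t - q.[t]| <= K * t ^+ N by near: t.
have hg : `|g t - r.[t]| <= L * t ^+ N by near: t.
have hq : `|q.[t]| <= Mq by near: t.
have hr : `|r.[t]| <= Mr by near: t.
have hg' : `|g t| <= L + Mr.
  rewrite -[g t](subrK r.[t]) (le_trans (ler_normD _ _))// lerD//.
  by rewrite (le_trans hg)// ler_piMr.
have -> : f t * g t - (q * r).[t] = (f t - q.[t]) * g t + q.[t] * (g t - r.[t]).
  by rewrite hornerM; ring.
apply: (le_trans (ler_normD _ _)); rewrite [leRHS]mulrDl lerD// normrM.
  by rewrite mulrAC ler_pM.
by rewrite -mulrA ler_pM.
Unshelve. all: by end_near. Qed.

Lemma approxX N f q k : approx N f q -> approx N (fun t => f t ^+ k) (q ^+ k).
Proof.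
move=> fq; elim: k => [|k IH].
  by rewrite expr0; exact: (approx_cst N 1).
rewrite exprS; have := approxM fq IH; apply: approx_near; near=> t.
by rewrite exprS.
Unshelve. all: by end_near. Qed.

Lemma approx_sum N n (f : nat -> R -> R) (q : nat -> {poly R}) :
  (forall k, approx N (f k) (q k)) ->
  approx N (fun t => \sum_(k < n) f k t) (\sum_(k < n) q k).
Proof.
move=> fq; elim: n => [|n IH].
  rewrite big_ord0; have := approx_cst N 0; rewrite polyC0; apply: approx_near.
  by near=> t; rewrite big_ord0.
rewrite big_ord_recr /=; have := approxD IH (fq n); apply: approx_near; near=> t.
by rewrite big_ord_recr.
Unshelve. all: by end_near. Qed.

Lemma small_at_right_le0 (c K : R) : (\forall t \near 0^'+, c <= K * t) -> c <= 0.
Proof.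
move=> h.
have : K * t @[t --> 0^'+] --> K * 0.
  by apply: cvgMr; apply: cvg_within_filter; exact: cvg_id.
rewrite mulr0 => h0.
by apply: (ler_cvg_to (cvg_cst c) h0).
Qed.

(** The constant term is a limit at 0, hence 0; dividing by [t] then lowers the order by one and
    exposes the next coefficient. *)
Lemma approx0_coef N q : approx N (fun=> 0) q -> forall i, (i < N)%N -> q`_i = 0.
Proof.
elim: N q => // N IH q [K K0 qK].
have [d [c qE]] : exists d c, q = d * 'X + c%:P.
  elim/poly_ind: q {qK} => [|d c _]; last by exists d, c.
  by exists 0, 0; rewrite mul0r addr0.
have [M M0 dM] := horner_bounded d.
have c0 : c = 0.
  apply/eqP; rewrite -normr_le0; apply: (@small_at_right_le0 _ (K + M)).
  near=> t.
  have t0 : 0 < t by near: t; exact: nbhs_right_gt.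
  have t1 : t <= 1 by near: t; exact: nbhs_right_le.
  have -> : c = q.[t] - d.[t] * t by rewrite qE !hornerE; ring.
  rewrite (le_trans (ler_normB _ _))// mulrDl lerD//.
    have : `|0 - q.[t]| <= K * t ^+ N.+1 by near: t.
    rewrite sub0r normrN => /le_trans; apply; rewrite ler_wpM2l// exprS.
    by rewrite ler_piMr// ?exprn_ile1// ltW.
  rewrite normrM (gtr0_norm t0) ler_wpM2r ?(ltW t0)//.
  by near: t.
have dN : approx N (fun=> 0) d.
  exists K => //; near=> t.
  have t0 : 0 < t by near: t; exact: nbhs_right_gt.
  have : `|0 - q.[t]| <= K * t ^+ N.+1 by near: t.
  rewrite !sub0r !normrN qE c0 !hornerE normrM (gtr0_norm t0) exprSr mulrA.
  by rewrite ler_pM2r.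
by case=> [|i] iN; rewrite qE c0 addr0 coefMX //=; exact: IH.
Unshelve. all: by end_near. Qed.

Lemma approx_uniq N f q r : approx N f q -> approx N f r ->
  forall i, (i < N)%N -> q`_i = r`_i.
Proof.
move=> fq fr i iN; apply/eqP; rewrite -subr_eq0 -coefB; apply/eqP.
move: i iN; apply: approx0_coef.
have h := approxM (approx_cst N (-1)) fr.
have := approxD fq h; rewrite polyCN polyC1 mulN1r.
by apply: approx_near; near=> t; rewrite mulN1r subrr.
Unshelve. all: by end_near. Qed.

End Approx.

(** * The recursion encoded in the generating function *)

Section GeneratingFunction.
Variable R : realType.
Implicit Types (c : nat -> R) (p : {poly R}).

(** The coefficient sequences of power series with a positive radius of convergence. *)
Definition geom_bounded c : Prop :=
  exists M D : R, [/\ 0 <= M, 0 < D & forall k, `|c k| <= M * D ^+ k].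

Lemma half_sum n : \sum_(k < n) (2^-1 : R) ^+ k <= 2.
Proof.
suff -> : \sum_(k < n) (2^-1 : R) ^+ k = 2 - 2 * 2^-1 ^+ n.
  by rewrite gerBl mulr_ge0// exprn_ge0// invr_ge0.
elim: n => [|n IH]; first by rewrite big_ord0 expr0; ring.
by rewrite big_ord_recr /= IH exprS; field.
Qed.

(** For [D * |t| <= 1/2] the tail is at most the bound of its first term times a geometric series of
    ratio 1/2, whose sum is the constant 2. *)
Lemma series_tail c (M D t s : R) n : 0 <= D ->
  (forall k, `|c k| <= M * D ^+ k) -> D * `|t| <= 2^-1 ->
  series (fun k => c k * t ^+ k) @ \oo --> s ->
  `|s - \sum_(k < n) c k * t ^+ k| <= 2 * M * (D * `|t|) ^+ n.
Proof.
move=> D0 cM Dt cs.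
have M0 : 0 <= M by rewrite (le_trans (normr_ge0 (c 0)))// (le_trans (cM 0))// expr0 mulr1.
have h : (`|series (fun k => c k * t ^+ k) m - \sum_(k < n) c k * t ^+ k|)
   @[m --> \oo] --> `|s - \sum_(k < n) c k * t ^+ k|.
  by apply: cvg_norm; apply: cvgB => //; exact: cvg_cst.
apply: (ler_cvg_to h (cvg_cst _)).
near=> m.
have nm : (n <= m)%N by near: m; exact: nbhs_infty_ge.
rewrite /series /= (big_cat_nat (n := n))//= !big_mkord addrC addrK.
apply: (le_trans (ler_norm_sum _ _ _)).
rewrite -{1}[n]add0n big_addn big_mkord.
have Dt0 : 0 <= D * `|t| by rewrite mulr_ge0.
apply: (@le_trans _ _ (\sum_(i < m - n) M * (D * `|t|) ^+ n * 2^-1 ^+ i)).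
  apply: ler_sum => i _; rewrite normrM normrX.
  apply: (@le_trans _ _ (M * D ^+ (i + n) * `|t| ^+ (i + n))).
    by rewrite ler_wpM2r// exprn_ge0.
  rewrite -mulrA -exprMn exprD [X in M * X]mulrC mulrA ler_wpM2l//.
    by rewrite mulr_ge0// exprn_ge0.
  by rewrite lerXn2r// nnegrE.
rewrite -mulr_sumr [2 * M]mulrC -!mulrA ler_wpM2l// mulrC ler_wpM2r ?exprn_ge0//.
exact: half_sum.
Unshelve. all: by end_near. Qed.

Lemma approx_series (f : R -> R) c N : geom_bounded c ->
  (\forall t \near 0^'+, series (fun k => c k * t ^+ k) @ \oo --> f t) ->
  approx N f (\poly_(k < N) c k).
Proof.
move=> [M [D [M0 D0 cM]]] cf; exists (2 * M * D ^+ N).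
  by rewrite !mulr_ge0// exprn_ge0// ltW.
near=> t.
have t0 : 0 < t by near: t; exact: nbhs_right_gt.
have Dt : D * `|t| <= 2^-1.
  rewrite gtr0_norm// mulrC -ler_pdivlMr//.
  by near: t; apply: nbhs_right_le; rewrite divr_gt0.
rewrite horner_poly -mulrA -exprMn -[in leRHS](gtr0_norm t0).
apply: (series_tail N (ltW D0) cM Dt).
by near: t.
Unshelve. all: by end_near. Qed.

(** Without constant term in [p], [f t = O(t)], so the terms of the exponential series from [N] on
    contribute [O(t^N)], and the finitely many others are polynomial in [f]. *)
Lemma approx_expR (f : R -> R) p N : approx N f p -> p`_0 = 0 ->
  approx N (fun t => expR (f t)) (\sum_(k < N) k`!%:R^-1 *: p ^+ k).
Proof.
(* At order 0 only boundedness of [f] is available, not [f t = O(t)]. *)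
case: N => [|N] fp p0.
  have [K K0 fK] := fp; rewrite big_ord0.
  have [M M0 pM] := horner_bounded p.
  exists (expR (K + M)); first exact: expR_ge0.
  near=> t; rewrite horner0 subr0 expr0 mulr1 ger0_norm ?expR_ge0// ler_expR.
  rewrite (le_trans (ler_norm _))// -[f t](subrK p.[t]) (le_trans (ler_normD _ _))//.
  rewrite lerD//; last by near: t.
  have : `|f t - p.[t]| <= K * t ^+ 0 by near: t.
  by rewrite expr0 mulr1.
have [L L0 fL] : exists2 L : R, 0 <= L & \forall t \near 0^'+, `|f t| <= L * t.
  have [K K0 fK] := fp.
  have [d [c pE]] : exists (d : {poly R}) (c : R), p = d * 'X + c%:P.
    elim/poly_ind: p {fp p0 fK} => [|d c _]; last by exists d, c.
    by exists 0, 0; rewrite mul0r addr0.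
  have c0 : c = 0 by move: p0; rewrite pE coefD coefMX coefC eqxx add0r.
  have [M M0 dM] := horner_bounded d.
  exists (K + M); first exact: addr_ge0.
  near=> t.
  have t0 : 0 < t by near: t; exact: nbhs_right_gt.
  have t1 : t <= 1 by near: t; exact: nbhs_right_le.
  rewrite -[f t](subrK p.[t]) (le_trans (ler_normD _ _))// mulrDl lerD//.
    have : `|f t - p.[t]| <= K * t ^+ N.+1 by near: t.
    move=> /le_trans; apply; rewrite ler_wpM2l// exprS.
    by rewrite ler_piMr// ?exprn_ile1// ltW.
  rewrite pE c0 !hornerE normrM (gtr0_norm t0) ler_wpM2r ?(ltW t0)//.
  by near: t.
have [E E0 hE] : approx N.+1 (fun t => \sum_(k < N.+1) k`!%:R^-1 * f t ^+ k)
   (\sum_(k < N.+1) k`!%:R^-1 *: p ^+ k).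
  apply: (@approx_sum _ _ _ (fun k t => k`!%:R^-1 * f t ^+ k) (fun k => k`!%:R^-1 *: p ^+ k)) => k.
  rewrite -mul_polyC; apply: approxM; [exact: approx_cst|exact: approxX].
exists (2 * L ^+ N.+1 + E); first by rewrite addr_ge0// mulr_ge0// exprn_ge0.
near=> t.
have t0 : 0 < t by near: t; exact: nbhs_right_gt.
have fLt : `|f t| <= L * t by near: t.
have f12 : `|f t| <= 2^-1.
  rewrite (le_trans fLt)// (@le_trans _ _ ((L + 1) * t))//.
    by rewrite ler_wpM2r ?(ltW t0)// lerDl.
  rewrite mulrC -ler_pdivlMr ?ltr_wpDl//.
  by near: t; apply: nbhs_right_le; rewrite divr_gt0// ltr_wpDl.
rewrite -[expR _](subrK (\sum_(k < N.+1) k`!%:R^-1 * f t ^+ k)) -addrA.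
apply: (le_trans (ler_normD _ _)); rewrite [leRHS]mulrDl lerD//; last by near: t.
(* The tail bound with coefficients 1/k!, [M = D = 1] and the variable [f t]. *)
apply: (@le_trans _ _ (2 * 1 * (1 * `|f t|) ^+ N.+1)).
  apply: (@series_tail (fun k => k`!%:R^-1)) => //.
  - move=> k; rewrite expr1n mulr1 normfV ger0_norm// invf_le1 ?ltr0n ?fact_gt0//.
    by rewrite ler1n fact_gt0.
  - by rewrite mul1r.
  - rewrite (_ : (fun k => _) = exp_coeff (f t)) ?exp_coeffE//.
    by rewrite -exp_coeffE; exact: is_cvg_series_exp_coeff.
rewrite mulr1 mul1r -mulrA ler_wpM2l// -exprMn lerXn2r// nnegrE//.
by rewrite mulr_ge0// ltW.
Unshelve. all: by end_near. Qed.

Lemma horner_inj p q : (forall x : R, p.[x] = q.[x]) -> p = q.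
Proof.
move=> pq; apply/eqP; rewrite -subr_eq0; apply/negPn/negP => d0.
pose s := [seq (n%:R : R) | n <- iota 0 (size (p - q))].
have us : uniq s.
  by rewrite map_inj_uniq ?iota_uniq// => m n /eqP; rewrite eqr_nat => /eqP.
have rs : all (root (p - q)) s.
  by apply/allP => _ /mapP[n _ ->]; rewrite /root hornerD hornerN pq subrr.
by have := max_poly_roots d0 rs us; rewrite size_map size_iota ltnn.
Qed.

(** At fixed [x], the coefficient of [t^n] is read off from two expansions of
    [gamma * exp (alpha * x)]. As [alpha] has no constant term, truncating everything at an order
    [N > n] does not alter it; polynomials in [x] with equal values are then equal. *)
Lemma sheffer_coef (gamma alpha : R -> R) (g a : nat -> R) (p : nat -> {poly R}) :
  geom_bounded g -> geom_bounded a -> a 0 = 0 ->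
  (\forall t \near 0^'+, series (fun k => g k * t ^+ k) @ \oo --> gamma t) ->
  (\forall t \near 0^'+, series (fun k => a k * t ^+ k) @ \oo --> alpha t) ->
  (forall x, geom_bounded (fun k => (p k).[x])) ->
  (forall x, \forall t \near 0^'+,
    series (fun k => (p k).[x] * t ^+ k) @ \oo --> gamma t * expR (alpha t * x)) ->
  forall n N, (n < N)%N -> p n = \poly_(k < N)
    (((\poly_(j < N) g j) * (\poly_(j < N) a j) ^+ k)`_n / k`!%:R).
Proof.
move=> gB aB a0 gc ac pB pc n N nN; apply: horner_inj => x.
have hg := approx_series N gB gc; have ha := approx_series N aB ac.
have hax := approxM ha (approx_cst N x).
have he := approxM hg (approx_expR hax _).
have := approx_uniq (approx_series N (pB x) (pc x)) (he _).
rewrite coefM big_ord1 coef_poly a0 if_same mul0r => /(_ erefl) /(_ n nN).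
rewrite coef_poly nN => ->.
rewrite horner_poly mulr_sumr coef_sum; apply: eq_bigr => k _.
rewrite -scalerAr coefZ exprMn -polyC_exp mulrA coefMC; ring.
Qed.

(** The coefficient form of [d/dx (gamma * exp (alpha * x)) = alpha * (gamma * exp (alpha * x))]:
    multiplying [gamma * alpha^k / k!] by [alpha] is a convolution with the sequence [a]. *)
Lemma sheffer_deriv (gamma alpha : R -> R) (g a : nat -> R) (p : nat -> {poly R}) :
  geom_bounded g -> geom_bounded a -> a 0 = 0 ->
  (\forall t \near 0^'+, series (fun k => g k * t ^+ k) @ \oo --> gamma t) ->
  (\forall t \near 0^'+, series (fun k => a k * t ^+ k) @ \oo --> alpha t) ->
  (forall x, geom_bounded (fun k => (p k).[x])) ->
  (forall x, \forall t \near 0^'+,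
    series (fun k => (p k).[x] * t ^+ k) @ \oo --> gamma t * expR (alpha t * x)) ->
  forall n, (p n)`_0 = g n /\ (p n)^`() = \sum_(j < n) a j.+1 *: p (n - j.+1)%N.
Proof.
move=> gB aB a0 gc ac pB pc n; have pE := sheffer_coef gB aB a0 gc ac pB pc.
split.
  by rewrite (pE n n.+1)// coef_poly /= expr0 mulr1 coef_poly ltnSn fact0 divr1.
apply/polyP => k; pose N := (n + k).+2.
have -> : \sum_(j < n) a j.+1 *: p (n - j.+1)%N = \sum_(j < n.+1) a j *: p (n - j)%N.
  by rewrite big_ord_recl /= a0 scale0r add0r; apply: eq_bigr.
rewrite coef_deriv (pE n N) ?coef_poly; last by rewrite /N; lia.
have -> : (k.+1 < N)%N by rewrite /N; lia.
rewrite coef_sum exprSr mulrA coefMr mulr_suml -sumrMnl; apply: eq_bigr => j _.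
rewrite coefZ (pE (n - j)%N N) ?coef_poly; last by rewrite /N; lia.
have -> : (k < N)%N by rewrite /N; lia.
have -> : (j < N)%N by move: (ltn_ord j); rewrite /N; lia.
rewrite factS natrM -mulr_natr; field.
by rewrite nat1r !pnatr_eq0/= -lt0n fact_gt0.
Qed.

End GeneratingFunction.

(** * Sheffer polynomials as real polynomials *)

Section ComplexToReal.
Variable R : realType.
Local Notation C := R[i].

Lemma normcE (z : C) : `|z| = (ComplexField.Normc.normc z)%:C.
Proof. by []. Qed.

Lemma normc_Re (z : C) : `|complex.Re z| <= ComplexField.Normc.normc z.
Proof. by have := normc_ge_Re z; rewrite lecR. Qed.

Lemma normc_Im (z : C) : `|complex.Im z| <= ComplexField.Normc.normc z.
Proof.
case: z => x y /=; rewrite -sqrtr_sqr ler_wsqrtr//.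
by rewrite lerDr sqr_ge0.
Qed.

Lemma cvg_ReIm (T : Type) (F : set_system T) (f : T -> C) (l : C) : Filter F ->
  f @ F --> l -> (fun x => complex.Re (f x)) @ F --> complex.Re l /\
                 (fun x => complex.Im (f x)) @ F --> complex.Im l.
Proof.
move=> FF /cvgrPdist_lt fl.
by split; apply/cvgrPdist_lt => e e0; have := fl e%:C;
  rewrite ltcR => /(_ e0); apply: filterS => x; rewrite normcE ltcR;
  apply: le_lt_trans; [have := normc_Re (l - f x)|have := normc_Im (l - f x)];
  case: (l) (f x) => ? ? [? ?].
Qed.

Lemma near_real_complex (U : set C) : nbhs (0 : C) U ->
  \forall t \near 0^'+, U (t : R)%:C.
Proof.
move=> /nbhs_ballP[e /= e0 eU].
have [r r0 re] : exists2 r : R, 0 < r & r%:C = e.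
  by move: e0; case: (e) => x y; rewrite ltcE/= => /andP[/eqP -> x0]; exists x.
near=> t; apply: eU; rewrite -ball_normE /= sub0r normrN normcE -re ltcR.
rewrite /= expr0n addr0 sqrtr_sqr gtr0_norm.
  by near: t; exact: nbhs_right_lt.
by near: t; exact: nbhs_right_gt.
Unshelve. all: by end_near. Qed.

End ComplexToReal.

Section ShefferReal.
Variable R : realType.
Local Notation C := R[i].
Local Notation RC := (real_complex R).

Lemma Re_sum n (u : nat -> C) :
  complex.Re (\sum_(0 <= k < n) u k) = \sum_(0 <= k < n) complex.Re (u k).
Proof. by rewrite (big_morph _ (id1 := 0) (op1 := +%R) _ _)// => -[? ?] []. Qed.

Lemma Im_sum n (u : nat -> C) :
  complex.Im (\sum_(0 <= k < n) u k) = \sum_(0 <= k < n) complex.Im (u k).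
Proof. by rewrite (big_morph _ (id1 := 0) (op1 := +%R) _ _)// => -[? ?] []. Qed.

Lemma ReM_real (z : C) (r : R) : complex.Re (z * r%:C) = complex.Re z * r.
Proof. by case: z => x y /=; rewrite mulr0 subr0. Qed.

Lemma ImM_real (z : C) (r : R) : complex.Im (z * r%:C) = complex.Im z * r.
Proof. by case: z => x y /=; rewrite mulr0 add0r. Qed.

Lemma real_Im (z : C) : (z \is Num.real) = (complex.Im z == 0).
Proof. by case: z => x y; rewrite complex_real. Qed.

Lemma ReIm_horner (q : {poly C}) (x : R) :
  complex.Re q.[x%:C] = (\poly_(i < size q) complex.Re q`_i).[x] /\
  complex.Im q.[x%:C] = (\poly_(i < size q) complex.Im q`_i).[x].
Proof.
rewrite !horner_poly horner_coef.
rewrite -(big_mkord xpredT (fun i => q`_i * x%:C ^+ i)) Re_sum Im_sum !big_mkord.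
by split; apply: eq_bigr => i _; rewrite -rmorphXn ?ReM_real ?ImM_real.
Qed.

Lemma real_valuedE (q : {poly C}) : real_valued q ->
  q = map_poly RC (\poly_(i < size q) complex.Re q`_i).
Proof.
move=> qr; have q0 : \poly_(i < size q) complex.Im q`_i = 0.
  apply: horner_inj => x; have [_ <-] := ReIm_horner q x.
  by rewrite horner0; apply/eqP; rewrite -real_Im; exact: qr.
apply/polyP => i; rewrite coef_map coef_poly.
case: ltnP => iq; last by rewrite nth_default.
have := congr1 (fun p : {poly R} => p`_i) q0; rewrite coef_poly iq coef0.
by case: (q`_i) => ? ? /= ->.
Qed.

Lemma cvg_series_geom_bounded (c : nat -> R) (t : R) : 0 < t ->
  cvgn (series (fun k => c k * t ^+ k)) -> geom_bounded c.
Proof.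
move=> t0 /cvg_series_cvg_0 h.
have /cvg_seq_bounded[M [Mr hM]] : cvgn (fun k => c k * t ^+ k).
  by apply/cvg_ex; exists 0.
exists (`|M| + 1), t^-1; split; [exact: addr_ge0|by rewrite invr_gt0|move=> k].
rewrite exprVn -ler_pdivrMr ?invr_gt0 ?exprn_gt0// invrK.
have := hM (`|M| + 1); rewrite (le_lt_trans (ler_norm M)) ?ltrDl// => /(_ erefl).
by move=> /(_ k Logic.I) /=; rewrite normrM (gtr0_norm (exprn_gt0 _ t0)).
Qed.

Lemma cvg_series_ReIm (c : nat -> C) (t : R) (l : C) :
  series (fun k => c k * t%:C ^+ k) @ \oo --> l ->
  series (fun k => complex.Re (c k) * t ^+ k) @ \oo --> complex.Re l /\
  series (fun k => complex.Im (c k) * t ^+ k) @ \oo --> complex.Im l.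
Proof.
move=> /cvg_ReIm[re im]; split.
- move: re; rewrite /series /=; under eq_fun do rewrite Re_sum.
  by under eq_fun do under eq_bigr do rewrite -rmorphXn ReM_real.
- move: im; rewrite /series /=; under eq_fun do rewrite Im_sum.
  by under eq_fun do under eq_bigr do rewrite -rmorphXn ImM_real.
Qed.

Lemma cvg_series0 (c : nat -> R) (l : R) :
  series (fun k => c k * 0 ^+ k) @ \oo --> l -> l = c 0%N.
Proof.
move=> h; apply: (cvg_unique _ h) => //; apply: cvg_near_cst.
near=> n.
have n0 : (0 < n)%N by near: n; exact: nbhs_infty_gt.
rewrite /series /= big_ltn// expr0 mulr1 big_nat big1 ?addr0// => i /andP[i0 _].
by rewrite expr0n gtn_eqF// mulr0.
Unshelve. all: by end_near. Qed.

Lemma analytic_at0_real (f : C -> C) : analytic_at f 0 -> exists c : nat -> R,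
  [/\ geom_bounded c, complex.Re (f 0) = c 0%N &
   \forall t \near 0^'+, series (fun k => c k * t ^+ k) @ \oo --> complex.Re (f t%:C)].
Proof.
move=> [c cf]; exists (fun k => complex.Re (c k)).
have h : \forall t \near 0^'+,
    series (fun k => complex.Re (c k) * t ^+ k) @ \oo --> complex.Re (f t%:C).
  have := near_real_complex cf; apply: filterS => t.
  by under eq_fun do rewrite subr0; move=> /cvg_series_ReIm[].
split => //.
- have [t [t0 ht]] : exists t : R, 0 < t /\
    series (fun k => complex.Re (c k) * t ^+ k) @ \oo --> complex.Re (f t%:C).
    near (0 : R)^'+ => t; exists t; split; first by near: t; exact: nbhs_right_gt.
    by near: t.
  by apply: (cvg_series_geom_bounded t0); apply/cvg_ex; exists (complex.Re (f t%:C)).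
- have := nbhs_singleton cf; rewrite subrr => h0.
  by have [+ _] := @cvg_series_ReIm c 0 _ h0 => /cvg_series0.
Unshelve. all: by end_near. Qed.

(** If [Im b] were nonzero, [x = pi / (2 Im b)] would make [cexp (b * x)] purely imaginary and
    nonzero. *)
Lemma cexp_real_forall (g b : C) : g != 0 -> complex.Im g = 0 ->
  (forall x : R, complex.Im (g * cexp (b * x%:C)) = 0) -> complex.Im b = 0.
Proof.
case: g => u v /= + v0; rewrite v0 => g0.
have u0 : u != 0 by move: g0; apply: contra => /eqP ->.
move=> h; apply/eqP/negPn/negP => b0.
have := h (pi / 2 / complex.Im b).
have E : complex.Im b * (pi / 2 / complex.Im b) = pi / 2 by field.
rewrite /cexp ReM_real ImM_real E mul0r addr0 sin_pihalf mulr1.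
by move/eqP; rewrite mulf_eq0 (negPf u0) /= gt_eqF// expR_gt0.
Qed.

(** The derivative is the limit of [f t / t] along positive reals, where [f] is real; if [c]
    vanished, the estimate would make this limit 0. *)
Lemma derive_real (f : C -> C) (c : R) : f 0 = 0 -> 'D_1 f 0 != 0 ->
  (\forall t \near 0^'+, complex.Im (f (t : R)%:C) = 0) ->
  (exists2 K : R, 0 <= K & \forall t \near 0^'+,
     `|complex.Re (f t%:C) - c * t| <= K * t ^+ 2) -> c != 0.
Proof.
move=> f0 Df fim [K K0 fre]; apply: contra Df => /eqP c0.
(* Without a derivative, ['D_1 f 0] is the default value 0 of a divergent limit. *)
have [df|/dvgP df] := pselect (derivable f (0 : C) 1); last by rewrite /derive df.
have h : (fun t : R => (t%:C)^-1 *: (f t%:C : C^o)) @ 0^'+ --> 'D_1 f (0 : C).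
  move: df => /cvg_ex[l hl]; have -> : 'D_1 f 0 = l by exact: cvg_lim hl.
  move=> A /hl; rewrite /= /nbhs /= /dnbhs /within => hA.
  have := near_real_complex hA => /= hA'.
  rewrite /nbhs /=; near=> t.
  have : t%:C != 0 :> C.
    by rewrite fmorph_eq0 gt_eqF//; near: t; exact: nbhs_right_gt.
  have : (t%:C != 0 :> C) -> A (t%:C^-1 *: (f (t%:C *: 1 + 0) - f 0)) by near: t.
  by rewrite f0 subr0 addr0 /GRing.scale /= mulr1 => h /h.
have [hre him] := cvg_ReIm _ h.
have tE t : complex.Re ((t%:C)^-1 *: (f t%:C : C^o)) = t^-1 * complex.Re (f t%:C) /\
    complex.Im ((t%:C)^-1 *: (f t%:C : C^o)) = t^-1 * complex.Im (f t%:C).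
  by rewrite /GRing.scale /= mulrC -fmorphV ReM_real ImM_real !(mulrC t^-1).
have re0 : complex.Re ('D_1 f 0) = 0.
  apply: (cvg_unique _ hre) => //.
  apply/cvgr0Pnorm_le => e e0; near=> t.
  have t0 : 0 < t by near: t; exact: nbhs_right_gt.
  rewrite (tE t).1 normrM gtr0_norm ?invr_gt0// mulrC ler_pdivrMr//.
  have : `|complex.Re (f t%:C) - c * t| <= K * t ^+ 2 by near: t.
  rewrite c0 mul0r subr0 => /le_trans; apply.
  rewrite expr2 mulrA ler_wpM2r ?(ltW t0)// (@le_trans _ _ ((K + 1) * t))//.
    by rewrite ler_wpM2r ?(ltW t0)// lerDl.
  rewrite mulrC -ler_pdivlMr ?ltr_wpDl//.
  by near: t; apply: nbhs_right_le; rewrite divr_gt0// ltr_wpDl.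
have im0 : complex.Im ('D_1 f 0) = 0.
  apply: (cvg_unique _ him) => //; apply: cvg_near_cst; near=> t.
  rewrite (tE t).2; have -> : complex.Im (f t%:C) = 0 by near: t.
  by rewrite mulr0.
by move: re0 im0; case: ('D_1 f 0) => x y /= -> ->.
Unshelve. all: by end_near. Qed.

(** At real [t] the generating series is real because the [P n] are. Its value at [x = 0] shows that
    [gamma t] is real; since [gamma t] is nonzero near 0, reality for all [x] forces [alpha t] to be
    real. The real parts of the Taylor coefficients then serve as [g] and [a]. *)
Lemma sheffer_real (P : nat -> {poly C}) : sheffer P ->
  (forall n, real_valued (P n)) ->
  exists (g a : nat -> R) (p : nat -> {poly R}),
    [/\ geom_bounded g, geom_bounded a, g 0%N = 1, a 1%N != 0 &
      forall n, [/\ P n = map_poly RC (n`!%:R *: p n), (p n)`_0 = g n &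
         (p n)^`() = \sum_(j < n) a j.+1 *: p (n - j.+1)%N]].
Proof.
move=> [gamma [alpha [U [U0 Uan [al0 dal ga0] Ugen]]]] Pr.
have [gan aan] := Uan _ (nbhs_singleton U0).
have [g [gB g0 gc]] := analytic_at0_real gan.
have [a [aB a0 ac]] := analytic_at0_real aan.
rewrite ga0 /= in g0; rewrite al0 /= in a0.
pose p n : {poly R} := n`!%:R^-1 *: \poly_(i < size (P n)) complex.Re (P n)`_i.
have n0 n : (n`!%:R : R) != 0 by rewrite pnatr_eq0 -lt0n fact_gt0.
have PE n : P n = map_poly RC (n`!%:R *: p n).
  by rewrite {1}(real_valuedE (Pr n)) scalerA divff// scale1r.
have Px n x : (P n).[x%:C] = (n`!%:R * (p n).[x])%:C.
  by rewrite PE horner_map /= hornerZ.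
have Ut : \forall t \near 0^'+, U (t : R)%:C by exact: near_real_complex.
have gen t x : U t%:C ->
    series (fun k => (p k).[x] * t ^+ k) @ \oo -->
      complex.Re (gamma t%:C * cexp (alpha t%:C * x%:C)) /\
    complex.Im (gamma t%:C * cexp (alpha t%:C * x%:C)) = 0.
  move=> /(Ugen x).
  have -> : (fun n => t%:C ^+ n / n`!%:R * (P n).[x%:C]) =
      (fun n => ((p n).[x])%:C * t%:C ^+ n).
    apply/funext => n; rewrite Px rmorphM /= rmorph_nat.
    by field; have := n0 n; rewrite -(fmorph_eq0 RC) rmorph_nat.
  move=> /cvg_series_ReIm[re im]; split => //.
  apply: (cvg_unique _ im) => //; apply: cvg_near_cst; near=> n.
  by rewrite /series /= big1// => i _; rewrite mul0r.
have cexp0 : cexp (0 : C) = 1.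
  by rewrite /cexp /= expR0 cos0 sin0 mulr1 mulr0.
have gim t : U t%:C -> complex.Im (gamma t%:C) = 0.
  by move=> /(gen _ 0)[_]; rewrite mulr0 cexp0 mulr1.
have gn0 : \forall t \near 0^'+, gamma (t : R)%:C != 0.
  have [K K0 hK] := approx_series 1 gB gc.
  near=> t; apply/negP => /eqP gt0.
  have t0 : 0 < t by near: t; exact: nbhs_right_gt.
  have : `|complex.Re (gamma t%:C) - (\poly_(k < 1) g k).[t]| <= K * t ^+ 1 by near: t.
  rewrite gt0 horner_poly big_ord1 expr0 mulr1 -g0 sub0r normrN normr1 expr1.
  apply/negP; rewrite -ltNge (@le_lt_trans _ _ ((K + 1) * t))//.
    by rewrite ler_wpM2r ?(ltW t0)// lerDl.
  rewrite mulrC -ltr_pdivlMr ?ltr_wpDl//.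
  by near: t; apply: nbhs_right_lt; rewrite divr_gt0// ltr_wpDl.
have aim : \forall t \near 0^'+, complex.Im (alpha (t : R)%:C) = 0.
  near=> t.
  have tU : U t%:C by near: t.
  apply: (@cexp_real_forall (gamma t%:C)); [by near: t|exact: gim|].
  by move=> x; have [] := gen t x tU.
have a1 : a 1%N != 0.
  apply: (derive_real al0 dal aim).
  have [K K0 hK] := approx_series 2 aB ac; exists K => //; near=> t.
  have : `|complex.Re (alpha t%:C) - (\poly_(k < 2) a k).[t]| <= K * t ^+ 2 by near: t.
  by rewrite horner_poly big_ord_recr big_ord1 /= -a0 mul0r add0r expr1.
have pc x : \forall t \near 0^'+, series (fun k => (p k).[x] * t ^+ k) @ \oo -->
    complex.Re (gamma t%:C) * expR (complex.Re (alpha t%:C) * x).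
  near=> t.
  have tU : U t%:C by near: t.
  have ai : complex.Im (alpha t%:C) = 0 by near: t.
  have [h _] := gen t x tU.
  suff -> : complex.Re (gamma t%:C) * expR (complex.Re (alpha t%:C) * x) =
     complex.Re (gamma t%:C * cexp (alpha t%:C * x%:C)) by [].
  have := gim t tU; move: ai; rewrite /cexp ReM_real ImM_real.
  case: (gamma t%:C) (alpha t%:C) => ? ? [? ?] /= -> ->.
  by rewrite !mul0r cos0 mulr1 subr0.
have pB x : geom_bounded (fun k => (p k).[x]).
  have [t [t0 ht]] : exists t : R, 0 < t /\ cvgn (series (fun k => (p k).[x] * t ^+ k)).
    near (0 : R)^'+ => t; exists t; split; first by near: t; exact: nbhs_right_gt.
    apply/cvg_ex; exists (complex.Re (gamma t%:C) * expR (complex.Re (alpha t%:C) * x)).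
    by near: t; exact: pc.
  exact: cvg_series_geom_bounded t0 ht.
exists g, a, p; split => // n; split => //.
- by have [] := sheffer_deriv gB aB (esym a0) gc ac pB pc n.
- by have [] := sheffer_deriv gB aB (esym a0) gc ac pB pc n.
Unshelve. all: by end_near. Qed.

End ShefferReal.

(** * Growth of Sheffer polynomials and of monomials *)

Section ShefferBounds.
Variable R : realType.
Implicit Types (c : nat -> R) (q : {poly R}).

Lemma geom_bounded_shift c : geom_bounded c -> geom_bounded (fun k => c k.+1).
Proof.
move=> [M [D [M0 D0 cM]]]; exists (M * D), D; split => //.
  by rewrite mulr_ge0// ltW.
by move=> k; rewrite -mulrA -exprS.
Qed.

(** Large weights do two things at once: they dominate the sequence, and they make the weighted sum
    of all terms but the first small. *)
Lemma geom_bounded_small c (e : R) : geom_bounded c -> 0 < e ->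
  exists M s0, [/\ 0 <= M, 0 < s0 & forall s, s0 <= s ->
    (forall k, `|c k| <= M * s ^+ k) /\
    forall n, \sum_(j < n) `|c j.+1| * s ^- j.+1 <= e].
Proof.
move=> [M [D [M0 D0 cM]]] e0.
(* [s >= 2 * D] makes the ratio [D / s] at most 1/2, so the sum is at most [2 * M * D / s]; the
   factor [M / e + 1] brings this below [e]. *)
exists M, (2 * D * (M / e + 1)).
have Me0 : 0 <= M / e by rewrite divr_ge0// ltW.
have M1 : 0 < M / e + 1 by rewrite ltr_wpDl.
split => //; first by rewrite !mulr_gt0.
move=> s ss.
have Ds : 2 * D <= s.
  by rewrite (le_trans _ ss)// ler_peMr ?lerDr// ?mulr_ge0// ltW.
have s0 : 0 < s by rewrite (lt_le_trans _ Ds)// mulr_gt0.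
have Ds0 : 0 <= D / s by rewrite divr_ge0// ltW.
have DsX : D / s <= 2^-1.
  by rewrite ler_pdivrMr// -ler_pdivrMl ?invr_gt0// invrK.
split=> [k|n].
  rewrite (le_trans (cM k))// ler_wpM2l// lerXn2r ?nnegrE ?(ltW D0) ?(ltW s0)//.
  by rewrite (le_trans _ Ds)// ler_peMl ?(ltW D0)// ler1n.
apply: (@le_trans _ _ (\sum_(j < n) M * (D / s) * 2^-1 ^+ j)).
  apply: ler_sum => j _.
  apply: (@le_trans _ _ (M * (D / s) ^+ j.+1)).
    by rewrite expr_div_n mulrA ler_wpM2r// invr_ge0 exprn_ge0// ltW.
  rewrite exprS -[leRHS]mulrA; apply: ler_wpM2l => //; apply: ler_wpM2l => //.
  by rewrite lerXn2r ?nnegrE.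
rewrite -mulr_sumr (@le_trans _ _ (M * (D / s) * 2))//.
  by rewrite ler_wpM2l ?half_sum// mulr_ge0// divr_ge0// ltW.
rewrite mulrA mulrAC ler_pdivrMr//.
rewrite (@le_trans _ _ (e * (2 * D * (M / e + 1))))//; last by rewrite ler_pM2l.
have -> : e * (2 * D * (M / e + 1)) = M * D * 2 + 2 * D * e by field; rewrite gt_eqF.
by rewrite lerDl !mulr_ge0// ltW.
Qed.

Lemma expR_partial (y : R) n : 0 <= y -> \sum_(k < n) y ^+ k / k`!%:R <= expR y.
Proof.
move=> y0; have -> : \sum_(k < n) y ^+ k / k`!%:R = series (exp_coeff y) n.
  by rewrite /series /= big_mkord; apply: eq_bigr.
apply: nondecreasing_cvgn_le; last exact: is_cvg_series_exp_coeff.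
by apply: nondecreasing_series => k _ _; exact: exp_coeff_ge0.
Qed.

Definition antideriv q : {poly R} :=
  \poly_(i < (size q).+1) (if i is j.+1 then q`_j / j.+1%:R else 0).

Lemma coef_antideriv q i :
  (antideriv q)`_i = if i is j.+1 then q`_j / j.+1%:R else 0.
Proof.
rewrite coef_poly; case: i => [//|j].
by rewrite ltnS; case: ltnP => // qj; rewrite nth_default// mul0r.
Qed.

Lemma antideriv_eq q r : r^`() = q -> r`_0 = 0 -> antideriv q = r.
Proof.
move=> rq r0; apply/polyP => -[|j]; rewrite coef_antideriv ?r0//.
by rewrite -rq coef_deriv -[X in X / _]mulr_natr mulfK// pnatr_eq0.
Qed.

Lemma deriv_antideriv q : (antideriv q)^`() = q.
Proof.
by apply/polyP => i; rewrite coef_deriv coef_antideriv -[LHS]mulr_natr divfK ?pnatr_eq0.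
Qed.

Section Family.
Variables (g a : nat -> R) (p : nat -> {poly R}).
Hypotheses (gB : geom_bounded g) (aB : geom_bounded a).
Hypotheses (g0 : g 0%N = 1) (a1 : a 1%N != 0).
Hypothesis p0 : forall n, (p n)`_0 = g n.
Hypothesis dp : forall n, (p n)^`() = \sum_(j < n) a j.+1 *: p (n - j.+1)%N.

Lemma sheffer_coefS n k : (p n)`_k.+1 =
  (\sum_(j < n) a j.+1 * (p (n - j.+1)%N)`_k) / k.+1%:R.
Proof.
have := congr1 (fun q : {poly R} => q`_k) (dp n).
rewrite coef_deriv coef_sum => h.
under [in RHS]eq_bigr do rewrite -coefZ.
by rewrite -h -[X in X / _]mulr_natr mulfK ?pnatr_eq0.
Qed.

(** Each step of the recursion multiplies the leading coefficient by a nonzero multiple of [a 1], so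
    it never vanishes. *)
Lemma sheffer_size n : size (p n) = n.+1.
Proof.
have hi k : forall m, (m < k)%N -> (p m)`_k = 0.
  elim: k => // k IH m mk; rewrite sheffer_coefS big1 ?mul0r// => j _.
  by rewrite IH ?mulr0//; move: (ltn_ord j); lia.
have ld : (p n)`_n != 0.
  elim: n => [|n IH]; first by rewrite p0 g0 oner_eq0.
  rewrite sheffer_coefS big_ord_recl /= big1 => [|j _].
    by rewrite addr0 subn1/= !mulf_neq0 ?invr_eq0 ?pnatr_eq0.
  by rewrite hi ?mulr0// /bump /=; move: (ltn_ord j); lia.
apply/eqP; rewrite eqn_leq; apply/andP; split.
  by apply/leq_sizeP => j; exact: hi.
by rewrite ltnNge; apply: contra ld => /leq_sizeP ->.
Qed.

(** Induction on [k], which the recursion lowers: each step costs the weighted sum of the [|a j|],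
    and a large weight [s] makes this sum at most [e]. *)
Lemma sheffer_coef_bound (e : R) : 0 < e -> exists M s : R, [/\ 0 <= M, 0 < s &
  forall n k, `|(p n)`_k| <= M * s ^+ n * e ^+ k / k`!%:R].
Proof.
move=> e0; have [M [s1 [M0 s10 gM]]] := geom_bounded_small gB e0.
have [M2 [s2 [_ s20 aM]]] := geom_bounded_small aB e0.
pose s := Num.max s1 s2.
have s0 : 0 < s by rewrite lt_max s10.
have {}gM k : `|g k| <= M * s ^+ k by apply: (gM s _).1; rewrite le_max lexx.
have {}aM n : \sum_(j < n) `|a j.+1| * s ^- j.+1 <= e.
  by apply: (aM s _).2; rewrite le_max lexx orbT.
exists M, s; split => // n k; elim: k n => [|k IH] n.
  by rewrite p0 expr0 fact0 mulr1 divr1.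
rewrite sheffer_coefS normrM normfV normr_nat factS natrM invfM.
rewrite (mulrC k.+1%:R^-1) [leRHS]mulrA ler_wpM2r ?invr_ge0//.
apply: (le_trans (ler_norm_sum _ _ _)).
apply: (@le_trans _ _ (\sum_(j < n)
    M * s ^+ n * e ^+ k / k`!%:R * (`|a j.+1| * s ^- j.+1))).
  apply: ler_sum => j _; rewrite normrM mulrC.
  have -> : M * s ^+ n * e ^+ k / k`!%:R * (`|a j.+1| * s ^- j.+1) =
     M * s ^+ (n - j.+1) * e ^+ k / k`!%:R * `|a j.+1|.
    rewrite -{1}(subnK (ltn_ord j)) exprD; field.
    by rewrite expf_neq0 ?gt_eqF ?ltr0n ?fact_gt0.
  by rewrite ler_wpM2r.
have -> : M * s ^+ n * e ^+ k.+1 / k`!%:R = M * s ^+ n * e ^+ k / k`!%:R * e.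
  by rewrite exprS; ring.
rewrite -mulr_sumr ler_wpM2l//.
by rewrite !mulr_ge0// ?exprn_ge0 ?invr_ge0// ltW.
Qed.

Lemma sheffer_growth (e : R) : 0 < e -> exists M s : R, [/\ 0 <= M, 0 < s &
  forall n x, `|(p n).[x]| <= M * s ^+ n * expR (e * `|x|)].
Proof.
move=> e0; have [M [s [M0 s0 pM]]] := sheffer_coef_bound e0.
exists M, s; split => // n x.
have Ms : 0 <= M * s ^+ n by rewrite mulr_ge0// exprn_ge0// ltW.
have ex0 : 0 <= e * `|x| by rewrite mulr_ge0// ltW.
apply: (@le_trans _ _ (M * s ^+ n * \sum_(k < size (p n)) (e * `|x|) ^+ k / k`!%:R)).
  rewrite horner_coef (le_trans (ler_norm_sum _ _ _))// mulr_sumr ler_sum// => k _.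
  rewrite normrM normrX.
  have -> : M * s ^+ n * ((e * `|x|) ^+ k / k`!%:R) =
     M * s ^+ n * e ^+ k / k`!%:R * `|x| ^+ k by rewrite exprMn; ring.
  by rewrite ler_wpM2r// exprn_ge0.
by rewrite ler_wpM2l// expR_partial.
Qed.

(* [wspan s q b]: [q] is a combination of the [p k] whose l1 norm with weights
   [s ^+ k] is at most [b]. *)
Inductive wspan (s : R) : {poly R} -> R -> Prop :=
| wspan0 b : 0 <= b -> wspan s 0 b
| wspanS q b k (c : R) : wspan s q b -> wspan s (q + c *: p k) (b + `|c| * s ^+ k).

Lemma wspan_le s q b b' : wspan s q b -> b <= b' -> wspan s q b'.
Proof.
move=> h; elim: h b' => [b0 b00 b' /(le_trans b00)|q0 b0 k c _ IH b' bb'].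
  exact: wspan0.
by rewrite -[b'](subrK (`|c| * s ^+ k)); apply/wspanS/IH; rewrite lerBrDr.
Qed.

Lemma wspanD s q r b d : wspan s q b -> wspan s r d -> wspan s (q + r) (b + d).
Proof.
move=> hq; elim=> [d0 d00|r0 d0 k c _ IH].
  by rewrite addr0; apply: wspan_le hq _; rewrite lerDl.
by rewrite !addrA; exact: wspanS.
Qed.

Lemma wspanZ s q b (x : R) : wspan s q b -> wspan s (x *: q) (`|x| * b).
Proof.
elim=> [b0 b00|q0 b0 k c _ IH]; first by rewrite scaler0; apply/wspan0/mulr_ge0.
by rewrite scalerDr mulrDr scalerA mulrA -normrM; exact: wspanS.
Qed.

Lemma wspan_sum s n (q : nat -> {poly R}) (b : nat -> R) :
  (forall k, (k < n)%N -> wspan s (q k) (b k)) ->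
  wspan s (\sum_(k < n) q k) (\sum_(k < n) b k).
Proof.
elim: n => [|n IH] h; first by rewrite !big_ord0; exact: wspan0.
rewrite !big_ord_recr /=; apply: wspanD (h n (ltnSn n)).
by apply: IH => k kn; apply: h; rewrite (ltn_trans kn).
Qed.

Lemma wspan_p s k : wspan s (p k) (s ^+ k).
Proof.
have := wspanS k 1 (wspan0 s (lexx 0)).
by rewrite add0r scale1r normr1 mul1r add0r.
Qed.

Lemma sheffer0 : p 0%N = 1.
Proof.
apply/polyP => -[|k]; first by rewrite p0 g0 coef1.
by rewrite sheffer_coefS big_ord0 mul0r coef1.
Qed.

(* Differentiation sends [p m.+1] to [a 1 *: p m] plus lower terms, which are
   negligible in the weighted norm for large weights, so that the
   antiderivative is bounded. *)
Lemma wspan_antideriv : exists s0 : R, 0 < s0 /\ forall s, s0 <= s ->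
  exists2 K : R, 0 <= K & forall q b, wspan s q b -> wspan s (antideriv q) (K * b).
Proof.
have a10 : 0 < `|a 1%N| / 2 by rewrite divr_gt0// normr_gt0.
have [M [s1 [M0 s10 gM]]] := geom_bounded_small gB a10.
have [M2 [s2 [_ s20 aM]]] := geom_bounded_small (geom_bounded_shift aB) a10.
exists (Num.max s1 s2); split; first by rewrite lt_max s10.
move=> s ss.
have s0 : 0 < s by rewrite (lt_le_trans _ ss)// lt_max s10.
have {}gM k : `|g k| <= M * s ^+ k.
  by apply: (gM s _).1; rewrite (le_trans _ ss)// le_max lexx.
have {}aM n : \sum_(j < n) `|a j.+2| * s ^- j.+1 <= `|a 1%N| / 2.
  by apply: (aM s _).2; rewrite (le_trans _ ss)// le_max lexx orbT.
(* Chosen to solve [K |a 1| = s (1 + M) + K |a 1| / 2], the balance that closes the induction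
   below. *)
pose K := 2 * s * (1 + M) / `|a 1%N|.
have K0 : 0 <= K by rewrite divr_ge0// !mulr_ge0// ?addr_ge0// ltW.
exists K => //.
suff pK m : wspan s (antideriv (p m)) (K * s ^+ m).
  move=> q b; elim=> [b0 b00|q0 b0 k c _ IH].
    have -> : antideriv 0 = 0 by apply: antideriv_eq; rewrite ?linear0 ?coef0.
    by apply/wspan0/mulr_ge0.
  have -> : antideriv (q0 + c *: p k) = antideriv q0 + c *: antideriv (p k).
    apply: antideriv_eq; first by rewrite derivD derivZ !deriv_antideriv.
    by rewrite coefD coefZ !coef_antideriv mulr0 addr0.
  by rewrite mulrDr mulrCA; apply/wspanD/wspanZ/pK.
have [n] := ubnP m; elim: n m => // n IH m; rewrite ltnS => mn.
(* The formula for the derivative of [p m.+1], integrated and solved for the antiderivative of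
   [p m]; [p 0 = 1] removes the constant term [g m.+1]. *)
have -> : antideriv (p m) = (a 1%N)^-1 *: (p m.+1 + (- g m.+1) *: p 0%N +
    \sum_(j < m) (- a j.+2) *: antideriv (p (m - j.+1)%N)).
  apply: antideriv_eq.
    rewrite derivZ !derivD derivZ sheffer0 -polyC1 derivC scaler0 addr0.
    rewrite dp big_ord_recl /= subn1 /= raddf_sum /=.
    rewrite -addrA -big_split /= big1 ?addr0 ?scalerA ?mulVf ?scale1r// => j _.
    by rewrite derivZ deriv_antideriv /bump /= add1n subSS scaleNr subrr.
  rewrite coefZ !coefD p0 sheffer0 coefZ coef1 /= mulr1 subrr add0r coef_sum.
  by rewrite big1 ?mulr0// => j _; rewrite coefZ coef_antideriv mulr0.
apply: (@wspan_le _ _ (`|(a 1%N)^-1| * (s ^+ m.+1 + `|- g m.+1| * s ^+ 0 +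
    \sum_(j < m) `|- a j.+2| * (K * s ^+ (m - j.+1))))).
  apply: wspanZ; apply: wspanD.
    by apply: wspanD; [exact: wspan_p|apply/wspanZ/wspan_p].
  apply: (@wspan_sum _ _ (fun j => (- a j.+2) *: antideriv (p (m - j.+1)%N))
    (fun j => `|- a j.+2| * (K * s ^+ (m - j.+1)))) => j jm.
  by apply/wspanZ/IH; lia.
rewrite normfV mulrC ler_pdivrMr ?normr_gt0//.
have -> : K * s ^+ m * `|a 1%N| = s ^+ m.+1 * (1 + M) + K * s ^+ m * (`|a 1%N| / 2).
  by rewrite /K exprS; field; rewrite normr_eq0.
rewrite lerD//.
  rewrite mulrDr mulr1 lerD2l expr0 mulr1 normrN mulrC.
  by rewrite (le_trans (gM _))// mulrC.
have Ks0 : 0 <= K * s ^+ m by rewrite mulr_ge0// exprn_ge0// ltW.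
apply: le_trans (ler_wpM2l Ks0 (aM m)).
rewrite mulr_sumr ler_sum// => j _; rewrite normrN.
have -> : s ^+ m = s ^+ (m - j.+1) * s ^+ j.+1 by rewrite -exprD subnK.
have -> : K * (s ^+ (m - j.+1) * s ^+ j.+1) * (`|a j.+2| / s ^+ j.+1) =
  `|a j.+2| * (K * s ^+ (m - j.+1)) by field; rewrite expf_neq0// gt_eqF.
by [].
Qed.

(** ['X^n / n!] is the [n]-fold antiderivative of [p 0 = 1], so its weighted l1 norm is at most
    [K ^+ n]; for weights [s >= C] that norm controls [N] up to the factor [M]. *)
Lemma sheffer_monomial_bound (N : {poly R} -> R) (M C : R) :
  0 <= M -> N 0 = 0 -> (forall q r, N (q + r) <= N q + N r) ->
  (forall (c : R) q, N (c *: q) = `|c| * N q) ->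
  (forall k, N (p k) <= M * C ^+ k) -> 0 <= C ->
  exists2 K : R, 0 <= K & forall n, N 'X^n <= M * n`!%:R * K ^+ n.
Proof.
move=> M0 N0 ND NZ Np C0.
have [s0 [s00 h]] := wspan_antideriv.
pose s := Num.max s0 C.
have s0s : s0 <= s by rewrite le_max lexx.
have [K K0 hK] := h s s0s.
have NM q b : wspan s q b -> N q <= M * b.
  elim=> [b0 b00|q0 b0 k c _ IH]; first by rewrite N0 mulr_ge0.
  rewrite (le_trans (ND _ _))// mulrDr lerD// NZ mulrCA ler_wpM2l//.
  rewrite (le_trans (Np k))// ler_wpM2l// lerXn2r ?nnegrE//.
    by rewrite le_max C0 orbT.
  by rewrite le_max lexx orbT.
have hX n : wspan s (n`!%:R^-1 *: 'X^n) (K ^+ n).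
  elim: n => [|n IH].
    rewrite fact0 invr1 scale1r expr0 -sheffer0 -[K ^+ 0](expr0 s); exact: wspan_p.
  have := hK _ _ IH; rewrite -exprS.
  suff -> : antideriv (n`!%:R^-1 *: 'X^n) = (n.+1)`!%:R^-1 *: 'X^(n.+1) by [].
  apply: antideriv_eq; last by rewrite coefZ coefXn mulr0.
  rewrite derivZ derivXn /= -scalerMnr scalerMnl; congr (_ *: _).
  by rewrite -[LHS]mulr_natr factS natrM; field; rewrite nat1r !pnatr_eq0/= -lt0n fact_gt0.
exists K => // n; have := NM _ _ (hX n); rewrite NZ ger0_norm ?invr_ge0//.
rewrite mulrC ler_pdivrMr ?ltr0n ?fact_gt0// => /le_trans; apply.
by rewrite mulrAC.
Qed.

End Family.
End ShefferBounds.

(** * Nonnegative polynomials are sums of two squares *)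

Section SumOfSquares.
Variable R : realType.
Implicit Types (p q : {poly R}).

(** Continuity from the right, [p(a + t) = p(a) + O(t)], by factoring out the root [a] of
    [p - p(a)]. *)
Lemma horner_at_right_ge0 p (a : R) :
  (forall x, x != a -> 0 <= p.[x]) -> 0 <= p.[a].
Proof.
move=> p0; have /factor_theorem[d dE] : root (p - (p.[a])%:P) a.
  by rewrite /root hornerD hornerN hornerC subrr.
have [M M0 hM] := horner_bounded (d \Po ('X + a%:P)).
rewrite -oppr_le0; apply: (@small_at_right_le0 _ _ M); near=> t.
have t0 : 0 < t by near: t; exact: nbhs_right_gt.
have h : p.[t + a] = p.[a] + (d \Po ('X + a%:P)).[t] * t.
  have := congr1 (fun q => q.[t + a]) dE; rewrite !(hornerE, horner_comp) addrK => <-.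
  by ring.
have : 0 <= p.[t + a] by apply: p0; rewrite -subr_eq0 addrK gt_eqF.
rewrite h -lerBlDl sub0r => /le_trans; apply.
rewrite (le_trans (ler_norm _))// normrM (gtr0_norm t0) ler_wpM2r ?(ltW t0)//.
by near: t.
Unshelve. all: by end_near. Qed.

Lemma linear_term_ge0 p (c : R) :
  (\forall t \near 0^'+, 0 <= p.[t] * t ^+ 2 + c * t) -> 0 <= c.
Proof.
move=> h; have [M M0 hM] := horner_bounded p.
rewrite -oppr_le0; apply: (@small_at_right_le0 _ _ M); near=> t.
have t0 : 0 < t by near: t; exact: nbhs_right_gt.
have : 0 <= p.[t] * t ^+ 2 + c * t by near: t.
rewrite expr2 mulrA -mulrDl pmulr_lge0// -lerBlDr sub0r => /le_trans; apply.
rewrite (le_trans (ler_norm _))// normrM (gtr0_norm t0) ler_wpM2r ?(ltW t0)//.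
by near: t.
Unshelve. all: by end_near. Qed.

(** A complex root [a + ib] supplies the quadratic factor, real roots giving [b = 0]. The remainder
    [c (X - a) + d] vanishes at the root, whence [d = 0] and [c b = 0]. *)
Lemma nonneg_poly_quadratic_factor q : (1 < size q)%N -> (forall x, 0 <= q.[x]) ->
  exists (r : {poly R}) (a b : R), [/\ q = r * (('X - a%:P) ^+ 2 + (b ^+ 2)%:P),
    (size r < size q)%N & forall x, 0 <= r.[x]].
Proof.
move=> q1 q0.
have [[a b] rz] : exists z : R[i], root (map_poly (real_complex R) q) z.
  by apply/closed_rootP; rewrite size_map_poly gtn_eqF.
pose m : {poly R} := ('X - a%:P) ^+ 2 + (b ^+ 2)%:P.
have sm : size m = 3%N.
  rewrite /m size_polyDl size_exp_XsubC// ltnS (leq_trans (size_polyC_leq1 _))//.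
have m0 : m != 0 by rewrite -size_poly_eq0 sm.
have mX x : m.[x] = (x - a) ^+ 2 + b ^+ 2 by rewrite /m !hornerE.
pose r := q %/ m.
have [c [d cd]] : exists c d, q %% m = c *: ('X - a%:P) + d%:P.
  exists (q %% m)`_1, ((q %% m)`_1 * a + (q %% m)`_0).
  apply/polyP => i; rewrite coefD coefZ coefB coefX !coefC.
  case: i => [|[|i]] /=; [by rewrite !(sub0r, mulrN); ring|by ring|].
  rewrite subr0 mulr0 addr0 nth_default//.
  by have := ltn_modpN0 q m0; rewrite sm ltnS => h; apply: leq_trans h _.
have qE : q = r * m + (c *: ('X - a%:P) + d%:P) by rewrite {1}(divp_eq q m) cd.
have qx x : q.[x] = r.[x] * ((x - a) ^+ 2 + b ^+ 2) + (c * (x - a) + d).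
  by rewrite {1}qE hornerD hornerM mX !hornerE.
have [cb d0] : c * b = 0 /\ d = 0.
  move: rz; rewrite /root qE rmorphD rmorphM /= hornerD hornerM.
  have -> : (map_poly (real_complex R) m).[a +i* b] = 0.
    rewrite /m rmorphD rmorphXn /= map_polyXsubC map_polyC /= !hornerE.
    by apply/eqP; rewrite eq_complex /=; apply/andP; split; apply/eqP; ring.
  rewrite mulr0 add0r rmorphD /= map_polyZ /= map_polyXsubC map_polyC !hornerE /=.
  rewrite eq_complex /= => /andP[/eqP h1 /eqP h2].
  by split; [rewrite -h2; ring|rewrite -h1; ring].
(* For a real root the sign of [q] kills [c]: close to [a], on either side, the linear term
   [c (x - a)] would dominate. *)
have c0 : c = 0.
  have [b0|b0] := eqVneq b 0; last first.
    by apply/eqP; move/eqP: cb; rewrite mulf_eq0 (negPf b0) orbF.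
  apply/eqP; rewrite eq_le; apply/andP; split.
    rewrite -oppr_ge0; apply: (@linear_term_ge0 (r \Po (a%:P - 'X))).
    near=> t; have -> : (r \Po (a%:P - 'X)).[t] = r.[a - t] by rewrite horner_comp !hornerE.
    have := q0 (a - t); rewrite qx d0 b0.
    by congr (0 <= _); ring.
  apply: (@linear_term_ge0 (r \Po (a%:P + 'X))).
  near=> t; have -> : (r \Po (a%:P + 'X)).[t] = r.[a + t] by rewrite horner_comp !hornerE.
  have := q0 (a + t); rewrite qx d0 b0.
  by congr (0 <= _); ring.
have {}qE : q = r * m by rewrite qE c0 d0 scale0r !addr0.
have rx x : x != a -> 0 <= r.[x].
  move=> xa; have := q0 x; rewrite qE hornerM mX pmulr_lge0//.
  by rewrite ltr_pwDl ?sqr_ge0// exprn_even_gt0// subr_eq0 xa orbT.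
exists r, a, b; split => //.
  rewrite size_divp// sm.
  by move: (size q) q1 => [|k] //= _; rewrite subSS ltnS leq_subr.
move=> x; have [->|/rx//] := eqVneq x a; exact: horner_at_right_ge0.
Unshelve. all: by end_near. Qed.

(** Brahmagupta's identity: a product of two sums of two squares is again one. It is used with
    [(X - a)^2 + b^2] as one factor, until a nonnegative constant remains. *)
Lemma nonneg_poly_sos q : (forall x, 0 <= q.[x]) ->
  exists u v : {poly R}, q = u ^+ 2 + v ^+ 2.
Proof.
have [n] := ubnP (size q); elim: n q => // n IH q; rewrite ltnS => qn q0.
have [q1|q1] := leqP (size q) 1.
  exists (Num.sqrt q`_0)%:P, 0; rewrite expr0n addr0 -polyC_exp sqr_sqrtr.
    exact: size1_polyC.
  by rewrite -horner_coef0.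
have [r [a [b [qE rq /IH[|u [v rE]]]]]] := nonneg_poly_quadratic_factor q1 q0.
  exact: leq_trans rq qn.
exists (('X - a%:P) * u - b *: v), (('X - a%:P) * v + b *: u).
by rewrite qE rE -!mul_polyC polyC_exp; ring.
Qed.

End SumOfSquares.

(** * Extension of positive functionals *)

Section RieszExtension.
Variables (R : realType) (T : Type).
Implicit Types (E F : set ((T -> R) * R)) (f g : T -> R).

(* Graphs of positive linear functionals defined on subspaces of [T -> R]. *)
Definition positive_graph E : Prop :=
  [/\ E (fun=> 0, 0),
      forall f g c d a, E (f, c) -> E (g, d) -> E (fun x => f x + a * g x, c + a * d) &
      forall f c, E (f, c) -> (forall x, 0 <= f x) -> 0 <= c].

Lemma positive_graph_le E f g c d : positive_graph E -> E (f, c) -> E (g, d) ->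
  (forall x, f x <= g x) -> c <= d.
Proof.
move=> [_ lin pos] fc gd fg; rewrite -subr_ge0.
have := lin _ _ _ _ (-1) gd fc => /pos; rewrite mulN1r; apply => x.
by rewrite mulN1r subr_ge0.
Qed.

(** The majorant [g] and the minorant [- g] of [f] make the set [S] of values on minorants nonempty
    and bounded, so [f] can be given the value [sup S]. *)
Lemma positive_graph_step E f : positive_graph E ->
  (exists g c, E (g, c) /\ forall x, `|f x| <= g x) ->
  exists F, [/\ E `<=` F, positive_graph F & exists c, F (f, c)].
Proof.
move=> Epos [g [c [Egc fg]]]; have [E0 lin pos] := Epos.
pose S := [set d | exists2 h, E (h, d) & forall x, h x <= f x].
have ubS h d : E (h, d) -> (forall x, f x <= h x) -> ubound S d.
  move=> Ehd fh e [h' Eh'e h'f]; apply: positive_graph_le Eh'e Ehd _ => // x.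
  exact: le_trans (h'f x) (fh x).
have S0 : S !=set0.
  exists (0 + (-1) * c), (fun x => 0 + (-1) * g x); first exact: lin.
  by move=> x; rewrite add0r mulN1r lerNl (le_trans _ (fg x))// -normrN ler_norm.
have hsS : has_sup S.
  by split => //; exists c; apply: ubS Egc _ => x; rewrite (le_trans _ (fg x))// ler_norm.
(* The largest value that positivity allows for [f]. *)
pose s := sup S.
pose F := [set hd | exists h d t, E (h, d) /\ hd = (fun x => h x + t * f x, d + t * s)].
exists F; split.
- move=> [h d] Ehd; exists h, d, 0; split => //; congr (_, _); last by rewrite mul0r addr0.
  by apply/funext => x; rewrite mul0r addr0.
- split.
  + exists (fun=> 0), 0, 0; split => //; congr (_, _); last by rewrite mul0r addr0.
    by apply/funext => x; rewrite mul0r addr0.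
  + move=> f1 f2 c1 c2 a [h1 [d1 [t1 [E1 [-> ->]]]]] [h2 [d2 [t2 [E2 [-> ->]]]]].
    exists (fun x => h1 x + a * h2 x), (d1 + a * d2), (t1 + a * t2).
    split; first exact: lin.
    by congr (_, _); [apply/funext => x|]; ring.
  + move=> f1 c1 [h [d [t [Ehd [-> ->]]]]] h0.
    have hE a : E (fun x => 0 + a * h x, 0 + a * d) by exact: lin.
    (* Dividing by [|t|] turns [h + t f >= 0] into a majorant of [f] when [t < 0] and a minorant
       when [t > 0]; [s] lies between the values of minorants and majorants. *)
    have [tn|tp|t0] := ltgtP t 0.
    * have tE y z : (y <= 0 + (- t)^-1 * z) = (0 <= z + t * y).
        by rewrite add0r ler_pdivlMl ?oppr_gt0// mulNr -subr_ge0 opprK.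
      rewrite -tE; apply: ge_sup => //; apply: ubS (hE _) _ => x.
      by rewrite tE.
    * have tE y z : (0 + (- t^-1) * z <= y) = (0 <= z + t * y).
        by rewrite add0r mulNr lerNl ler_pdivlMl// mulrN -subr_ge0 opprK.
      rewrite -tE; apply: ub_le_sup; first exact: hsS.2.
      by exists (fun x => 0 + (- t^-1) * h x) => // x; rewrite tE.
    * by rewrite t0 mul0r addr0; apply: pos Ehd _ => x; have := h0 x; rewrite t0 mul0r addr0.
- exists s, (fun=> 0), 0, 1; split => //; congr (_, _); last by rewrite mul1r add0r.
  by apply/funext => x; rewrite mul1r add0r.
Qed.

Lemma riesz_extension E : positive_graph E -> exists F, [/\ E `<=` F, positive_graph F &
  forall f, (exists g c, E (g, c) /\ forall x, `|f x| <= g x) -> exists c, F (f, c)].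
Proof.
(* Adjoining [E] in the property lets the empty chain, whose union is empty, satisfy Zorn's
   hypothesis too. *)
move=> Epos; pose Q A := positive_graph (A `|` E).
have [A [QA Amax]] : exists A, Q A /\ forall B, A `<` B -> ~ Q B.
  apply: Zorn_bigcup => C CQ Ctot.
  have C2 fc gd : (\bigcup_(X in C) X `|` E) fc -> (\bigcup_(X in C) X `|` E) gd ->
      exists X, [/\ positive_graph (X `|` E), (X `|` E) fc, (X `|` E) gd &
        X `<=` \bigcup_(X in C) X].
    have sub X : C X -> X `<=` \bigcup_(X in C) X by move=> CX y Xy; exists X.
    move=> [[X CX Xf]|Ef] [[Y CY Yg]|Eg].
    - have [XY|YX] := Ctot X Y CX CY.
        by exists Y; split; [exact: CQ|left; exact: XY|left|exact: sub].
      by exists X; split; [exact: CQ|left|left; exact: YX|exact: sub].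
    - by exists X; split; [exact: CQ|left|right|exact: sub].
    - by exists Y; split; [exact: CQ|right|left|exact: sub].
    - by exists set0; split; [rewrite set0U|right|right|].
  split; first by right; case: Epos.
  - move=> f g c d a fc gd; have [X [[_ lin _] Xf Xg XC]] := C2 _ _ fc gd.
    by case: (lin _ _ _ _ a Xf Xg) => [/XC|]; [left|right].
  - move=> f c fc f0; have [X [[_ _ pos] Xf _ _]] := C2 _ _ fc fc.
    exact: pos Xf f0.
exists (A `|` E); split => // f [g [c [Egc fg]]].
have [F [AF Fpos [d Fd]]] : exists F, [/\ A `|` E `<=` F, positive_graph F & exists d, F (f, d)].
  by apply: positive_graph_step => //; exists g, c; split => //; right.
exists d; have [FA|FA] := pselect (F `<=` A); first by left; exact: FA.
case: (Amax F).
  by split => // x Ax; apply: AF; left.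
rewrite /Q (_ : F `|` E = F)//; apply/setUidPl => x Ex; apply: AF; by right.
Qed.

(* The extension as a function; [xget] gives a junk value on functions
   that are not dominated. *)
Lemma riesz_extension_fun E : positive_graph E ->
  let dom f := exists g c, E (g, c) /\ forall x, `|f x| <= g x in
  exists Lam : (T -> R) -> R, [/\ forall f c, E (f, c) -> Lam f = c,
    forall f g a, dom f -> dom g -> Lam (fun x => f x + a * g x) = Lam f + a * Lam g &
    forall f g, dom f -> dom g -> (forall x, f x <= g x) -> Lam f <= Lam g].
Proof.
move=> Epos dom; have [F [EF Fpos Fdom]] := riesz_extension Epos.
have Fle f g c d := positive_graph_le Fpos (f := f) (g := g) (c := c) (d := d).
have [_ lin _] := Fpos.
pose Lam f := xget 0 [set c | F (f, c)].
have FL f c : F (f, c) -> F (f, Lam f).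
  by move=> Fc; rewrite /Lam; case: xgetP => [y _//|/(_ c)].
have LF f : dom f -> F (f, Lam f) by move=> /Fdom[c /FL].
have LE f c : F (f, c) -> Lam f = c.
  move=> Fc; have Ff := FL f c Fc.
  by apply/eqP; rewrite eq_le (Fle _ _ _ _ Ff Fc)// (Fle _ _ _ _ Fc Ff).
exists Lam; split => [f c /EF/LE//|f g a /LF fF /LF gF|f g /LF fF /LF gF fg].
  exact/LE/lin.
exact: Fle fF gF fg.
Qed.

End RieszExtension.

(** * The moment problem *)

Section RightRegularization.
Variables (R : realType) (F : R -> R).
Hypotheses (F_ge0 : forall x, 0 <= F x) (F_nd : {homo F : x y / x <= y}).

(** The right limit of [F] at [x], written as an infimum because [F] is nondecreasing. *)
Definition right_reg (x : R) : R := inf [set F z | z in [set z | x < z]].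

Let has_inf_reg x : has_inf [set F z | z in [set z | x < z]].
Proof.
split; first by exists (F (x + 1)), (x + 1) => //=; rewrite ltrDl.
by exists 0 => _ [z _ <-].
Qed.

Lemma right_reg_le x z : x < z -> right_reg x <= F z.
Proof. by move=> xz; apply: ge_inf; [exact: (has_inf_reg x).2|exists z]. Qed.

Lemma le_right_reg x : F x <= right_reg x.
Proof.
apply: lb_le_inf; first exact: (has_inf_reg x).1.
by move=> _ [z /= xz <-]; apply/F_nd/ltW.
Qed.

Lemma right_reg_lt x (e : R) : 0 < e -> exists2 z, x < z & F z < right_reg x + e.
Proof.
move=> /(inf_adherent)-/(_ _ (has_inf_reg x))[_ [z /= xz <-] h].
by exists z.
Qed.

Lemma right_reg_nd : {homo right_reg : x y / x <= y}.
Proof.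
move=> x y; rewrite le_eqVlt => /predU1P[->//|xy].
exact: le_trans (right_reg_le xy) (le_right_reg y).
Qed.

Lemma right_reg_right_continuous : right_continuous right_reg.
Proof.
move=> x; apply/cvgrPdist_lt => e /(right_reg_lt x)[z xz Fz].
near=> t.
have xt : x < t by near: t; exact: nbhs_right_gt.
have tz : t < z by near: t; exact: nbhs_right_lt.
rewrite distrC ger0_norm ?subr_ge0 ?right_reg_nd// ?ltW// ltrBlDl.
exact: le_lt_trans (right_reg_le tz) Fz.
Unshelve. all: by end_near. Qed.

Lemma cvg_right_reg x : F (x + t) @[t --> 0^'+] --> right_reg x.
Proof.
apply/cvgrPdist_lt => e /(right_reg_lt x)[z xz Fz].
near=> t.
have t0 : 0 < t by near: t; exact: nbhs_right_gt.
have tz : t <= z - x by near: t; apply: nbhs_right_le; rewrite subr_gt0.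
rewrite distrC ger0_norm ?subr_ge0 ?right_reg_le ?ltrDl// ltrBlDl.
by apply: le_lt_trans Fz; apply: F_nd; rewrite -lerBrDl.
Unshelve. all: by end_near. Qed.

Definition right_reg_cumulative : cumulative R R :=
  HB.pack right_reg
    (isCumulative.Build R _ R right_reg right_reg_nd right_reg_right_continuous).

End RightRegularization.

(** * Distribution functions attached to a positive functional *)

Section PositiveFunctional.
Variables (R : realType) (L : {poly R} -> R).
Hypothesis L_lin : forall p q (a : R), L (p + a *: q) = L p + a * L q.
Hypothesis L_sqr : forall q, 0 <= L (q ^+ 2).
Implicit Types (p q : {poly R}) (f g : R -> R).

Lemma functional0 : L 0 = 0.
Proof.
have := L_lin 0 0 1; rewrite scale1r addr0 mul1r => h.
by apply: (@addrI _ (L 0)); rewrite addr0 -h.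
Qed.

Lemma functionalD p q : L (p + q) = L p + L q.
Proof. by rewrite -{1}[q]scale1r L_lin mul1r. Qed.

Lemma functionalZ q a : L (a *: q) = a * L q.
Proof. by rewrite -[_ *: _]add0r L_lin functional0 add0r. Qed.

Lemma functional_ge0 q : (forall x, 0 <= q.[x]) -> 0 <= L q.
Proof. by move=> /nonneg_poly_sos[u [v ->]]; rewrite functionalD addr_ge0. Qed.

Lemma horner_le_sqr q x : `|q.[x]| <= (1 + q ^+ 2).[x].
Proof.
rewrite hornerD hornerC horner_exp; move: q.[x] => y.
by rewrite ler_norml; apply/andP; split; nra.
Qed.

Definition dominated f : Prop := exists q, forall x, `|f x| <= q.[x].

Lemma functional_extension : exists Lam : (R -> R) -> R,
  [/\ forall q, Lam (fun x => q.[x]) = L q,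
   forall f g a, dominated f -> dominated g ->
     Lam (fun x => f x + a * g x) = Lam f + a * Lam g &
   forall f g, dominated f -> dominated g -> (forall x, f x <= g x) -> Lam f <= Lam g].
Proof.
pose E := [set fc : (R -> R) * R | exists q, fc = ((fun x => q.[x]), L q)].
have Epos : positive_graph E.
  split.
  - exists 0; rewrite functional0; congr (_, _); apply/funext => x; by rewrite horner0.
  - move=> f g c d a [p [-> ->]] [q [-> ->]]; exists (p + a *: q).
    by rewrite L_lin; congr (_, _); apply/funext => x; rewrite hornerD hornerZ.
  - by move=> f c [q [-> ->]]; exact: functional_ge0.
have [Lam [h1 h2 h3]] := riesz_extension_fun Epos.
have dom f : dominated f -> exists g c, E (g, c) /\ forall x, `|f x| <= g x.
  by move=> [q fq]; exists (fun x => q.[x]), (L q); split => //; exists q.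
exists Lam; split.
- by move=> q; apply: h1; exists q.
- by move=> f g a /dom fd /dom gd; exact: h2.
- by move=> f g /dom fd /dom gd; exact: h3.
Qed.

Lemma poly_lipschitz q (N : R) : 0 <= N -> exists2 C : R, 0 <= C &
  forall x y, `|x| <= N -> `|y| <= N -> `|q.[x] - q.[y]| <= C * `|x - y|.
Proof.
move=> N0; elim/poly_ind: q => [|d c [C C0 dC]].
  by exists 0 => // x y _ _; rewrite !horner0 subrr normr0 mul0r.
exists (C * N + (C * N + `|d.[0]|)); first by rewrite !addr_ge0 ?mulr_ge0.
move=> x y xN yN.
have dy : `|d.[y]| <= C * N + `|d.[0]|.
  rewrite -[d.[y]](subrK d.[0]) (le_trans (ler_normD _ _))// lerD2r.
  by rewrite (le_trans (dC _ _ _ _))// ?normr0// subr0 ler_wpM2l.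
have -> : (d * 'X + c%:P).[x] - (d * 'X + c%:P).[y] =
    (d.[x] - d.[y]) * x + d.[y] * (x - y) by rewrite !hornerE; ring.
rewrite (le_trans (ler_normD _ _))// [leRHS]mulrDl lerD// normrM.
  by rewrite mulrAC ler_pM// dC.
by rewrite ler_wpM2r.
Qed.

Definition cut (y x : R) : R := (x <= y)%R%:R.

Lemma cut_ge0 y x : 0 <= cut y x. Proof. by rewrite /cut ler0n. Qed.
Lemma cut_le1 y x : cut y x <= 1. Proof. by rewrite /cut lern1 leq_b1. Qed.

Lemma cutB a b x : a <= b -> cut b x - cut a x = ((a < x) && (x <= b))%R%:R.
Proof.
rewrite /cut => ab; case: (leP x a) => xa /=; last by rewrite subr0.
by rewrite (le_trans xa ab) subrr.
Qed.

Lemma dominated_cut q y : dominated (fun x => q.[x] * cut y x).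
Proof.
exists (1 + q ^+ 2) => x; rewrite normrM (ger0_norm (cut_ge0 _ _)).
apply: (@le_trans _ _ `|q.[x]|).
  by rewrite ler_piMr// cut_le1.
exact: horner_le_sqr.
Qed.

Variable Lam : (R -> R) -> R.
Hypothesis LamE : forall q, Lam (fun x => q.[x]) = L q.
Hypothesis Lam_lin : forall f g a, dominated f -> dominated g ->
  Lam (fun x => f x + a * g x) = Lam f + a * Lam g.
Hypothesis Lam_le : forall f g, dominated f -> dominated g ->
  (forall x, f x <= g x) -> Lam f <= Lam g.

(** Up to right regularization, this is to become the integral of [q] over the half-line ending at
    [y] for the measure under construction; [q = 1] gives the mass. *)
Definition distr q (y : R) : R := Lam (fun x => q.[x] * cut y x).

Lemma dominatedD f g a : dominated f -> dominated g -> dominated (fun x => f x + a * g x).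
Proof.
move=> [p fp] [q gq]; exists (p + `|a| *: q) => x.
rewrite hornerD hornerZ (le_trans (ler_normD _ _))// lerD// normrM.
by rewrite ler_wpM2l.
Qed.

Lemma dominated_horner q : dominated (fun x => q.[x]).
Proof. by exists (1 + q ^+ 2) => x; exact: horner_le_sqr. Qed.

Lemma distr_ge0 q y : (forall x, 0 <= q.[x]) -> 0 <= distr q y.
Proof.
move=> q0; rewrite -functional0 -LamE.
apply: Lam_le; [exact: dominated_horner|exact: dominated_cut|].
by move=> x; rewrite horner0 mulr_ge0// cut_ge0.
Qed.

Lemma distr_nd q : (forall x, 0 <= q.[x]) -> {homo distr q : x y / x <= y}.
Proof.
move=> q0 a b ab; apply: Lam_le; do ?exact: dominated_cut.
by move=> x; rewrite ler_wpM2l// -subr_ge0 cutB// ler0n.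
Qed.

Lemma distrB q a b : distr q b - distr q a =
  Lam (fun x => q.[x] * cut b x + -1 * (q.[x] * cut a x)).
Proof. by rewrite Lam_lin; [rewrite mulN1r|exact: dominated_cut..]. Qed.

(** Positivity on ]a, b]: there [q] lies between [c - e] and [c + e], hence its increment lies
    between these multiples of the mass of the interval. *)
Lemma distr_lip q (c e a b : R) : a <= b ->
  (forall x, a < x <= b -> `|q.[x] - c| <= e) ->
  `|distr q b - distr q a - c * (distr 1 b - distr 1 a)| <= e * (distr 1 b - distr 1 a).
Proof.
move=> ab qc.
have d1 := dominatedD (-1) (dominated_cut 1 b) (dominated_cut 1 a).
have dq := dominatedD (-1) (dominated_cut q b) (dominated_cut q a).
(* The zero polynomial serves to bring a scalar multiple into the form [f + a * g] of [Lam_lin]. *)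
have dl (k : R) : k * (distr 1 b - distr 1 a) + L 0 =
    Lam (fun x => 0.[x] + k * (1.[x] * cut b x + -1 * (1.[x] * cut a x))).
  by rewrite Lam_lin ?LamE ?distrB; [rewrite addrC|exact: dominated_horner|].
have d01 (k : R) := dominatedD k (dominated_horner 0) d1.
have E x : q.[x] * cut b x + -1 * (q.[x] * cut a x) = q.[x] * (cut b x - cut a x).
  by ring.
have E1 x (k : R) : 0.[x] + k * (1.[x] * cut b x + -1 * (1.[x] * cut a x)) =
   k * (cut b x - cut a x) by rewrite horner0 hornerC; ring.
rewrite ler_norml; apply/andP; split.
  rewrite lerBrDl -mulNr -mulrDl -[leLHS]addr0 -functional0 dl distrB.
  apply: Lam_le => // x; rewrite E E1 cutB//.
  have [/qc|] := boolP (a < x <= b); last by rewrite !mulr0.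
  by rewrite ler_norml => /andP[]; rewrite !mulr1 lerBrDl.
rewrite lerBlDl -mulrDl -[leRHS]addr0 -functional0 dl distrB.
apply: Lam_le => // x; rewrite E E1 cutB//.
have [/qc|] := boolP (a < x <= b); last by rewrite !mulr0.
by rewrite ler_norml => /andP[_]; rewrite !mulr1 lerBlDl.
Qed.

(* Chebyshev's estimate of the mass carried outside [-r, r]. *)
Lemma distr_tail q (a b r : R) : (forall x, 0 <= q.[x]) -> a <= - r -> r <= b -> 0 < r ->
  L q - L (q * 'X ^+ 2) / r ^+ 2 <= distr q b - distr q a <= L q.
Proof.
move=> q0 ar rb r0; have ab : a <= b by lra.
have dq := dominatedD (-1) (dominated_cut q b) (dominated_cut q a).
have E x : q.[x] * cut b x + -1 * (q.[x] * cut a x) = q.[x] * ((a < x) && (x <= b))%R%:R.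
  by rewrite -cutB//; ring.
rewrite distrB; apply/andP; split; last first.
  rewrite -LamE; apply: Lam_le => //; first exact: dominated_horner.
  by move=> x; rewrite E ler_piMr// lern1 leq_b1.
rewrite mulrC -mulNr -L_lin -LamE; apply: Lam_le => //; first exact: dominated_horner.
move=> x; rewrite E hornerD hornerZ hornerM hornerXn.
have [/=|] := boolP ((a < x) && (x <= b)).
  move=> _; rewrite mulr1 gerDl mulNr oppr_le0; apply: mulr_ge0.
    by rewrite invr_ge0 sqr_ge0.
  by rewrite mulr_ge0// sqr_ge0.
rewrite mulr0 => xab.
have rx : r ^+ 2 <= x ^+ 2.
  rewrite -[x ^+ 2]real_normK ?num_real// lerXn2r ?nnegrE ?(ltW r0)//.
  move: xab; rewrite negb_and -leNgt -ltNge ler_normr => /orP[xa|xb].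
    by apply/orP; right; lra.
  by apply/orP; left; lra.
have -> : q.[x] + - r ^- 2 * (q.[x] * x ^+ 2) = q.[x] * (1 - x ^+ 2 / r ^+ 2).
  by ring.
by rewrite mulr_ge0_le0// subr_le0 ler_pdivlMr ?exprn_gt0// mul1r.
Qed.

End PositiveFunctional.

(** * Hamburger's moment problem *)

Section Hamburger.
Variable R : realType.
Implicit Types (p q : {poly R}).
Local Notation mR := (measurableTypeR R).

(** When [lo, hi] is cut into [m + 1] equal pieces, the increments of [W] telescope, and the total
    change of [U] is at most a constant over [m + 1], for every [m]. *)
Lemma constant_of_small_increments (U W : R -> R) (K lo hi : R) : lo <= hi ->
  (forall a b, lo <= a -> a <= b -> b <= hi ->
     `|U b - U a| <= K * (b - a) * (W b - W a)) -> U hi = U lo.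
Proof.
move=> lohi h; pose B := K * (hi - lo) * (W hi - W lo).
suff hm m : `|U hi - U lo| * m.+1%:R <= B.
  apply/eqP; rewrite -subr_eq0 -normr_le0 leNgt; apply/negP => U0.
  have B0 : 0 <= B by rewrite (le_trans _ (hm 0%N)).
  have := hm (Num.bound (B / `|U hi - U lo|)); apply/negP; rewrite -ltNge.
  rewrite mulrC -ltr_pdivrMr// (lt_le_trans (archi_boundP _))//.
    by rewrite divr_ge0// ltW.
  by rewrite ler_nat.
pose t i := lo + (hi - lo) * i%:R / m.+1%:R.
have m0 : (0 : R) < m.+1%:R by [].
have t0 : t 0%N = lo by rewrite /t mulr0 mul0r addr0.
have tm : t m.+1 = hi by rewrite /t mulfK ?gt_eqF// addrC subrK.
have tS i : t i.+1 - t i = (hi - lo) / m.+1%:R.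
  by rewrite /t -natr1; field; rewrite -?natr1 ?gt_eqF.
have hl0 : 0 <= hi - lo by rewrite subr_ge0.
have tlo i : lo <= t i by rewrite /t lerDl divr_ge0// mulr_ge0.
have thi i : (i <= m.+1)%N -> t i <= hi.
  move=> im; rewrite /t -lerBrDl ler_pdivrMr// ler_wpM2l// ler_nat//.
rewrite -ler_pdivlMr//.
have -> : U hi - U lo = \sum_(0 <= i < m.+1) (U (t i.+1) - U (t i)).
  by rewrite (telescope_sumr (fun i => U (t i)))// t0 tm.
have -> : B / m.+1%:R = \sum_(0 <= i < m.+1) (K * ((hi - lo) / m.+1%:R)) * (W (t i.+1) - W (t i)).
  by rewrite -mulr_sumr (telescope_sumr (fun i => W (t i)))// t0 tm /B; ring.
apply: (le_trans (ler_norm_sum _ _ _)); rewrite !big_nat; apply: ler_sum => i /andP[_ im].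
rewrite -(tS i); apply: h => //; last exact: thi.
by rewrite -subr_ge0 tS divr_ge0.
Qed.

Lemma lebesgue_stieltjes_ocitv (G : cumulative R R) (a b : R) : a <= b ->
  lebesgue_stieltjes_measure G (`]a, b]%classic : set mR) = (G b - G a)%:E.
Proof.
move=> ab; rewrite /lebesgue_stieltjes_measure /measure_extension.
by rewrite measurable_mu_extE/= ?wlength_itv_bnd//; exact: is_ocitv.
Qed.

Section MomentMeasure.
Variable L : {poly R} -> R.
Hypothesis L_lin : forall p q (a : R), L (p + a *: q) = L p + a * L q.
Hypothesis L_sqr : forall q, 0 <= L (q ^+ 2).
Variable Lam : (R -> R) -> R.
Hypothesis LamE : forall q, Lam (fun x => q.[x]) = L q.
Hypothesis Lam_lin : forall f g a, dominated f -> dominated g ->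
  Lam (fun x => f x + a * g x) = Lam f + a * Lam g.
Hypothesis Lam_le : forall f g, dominated f -> dominated g ->
  (forall x, f x <= g x) -> Lam f <= Lam g.

Let H q : R -> R := right_reg (distr Lam q).
Let G : R -> R := H 1.
Variable mu : {measure set mR -> \bar R}.
Hypothesis muE : forall a b : R, a <= b -> mu (`]a, b]%classic : set mR) = (G b - G a)%:E.

Let p1_ge0 x : (0 : R) <= (1 : {poly R}).[x]. Proof. by rewrite hornerC. Qed.

Let cvgH q : (forall x, 0 <= q.[x]) ->
  forall x, distr Lam q (x + t) @[t --> 0^'+] --> H q x.
Proof.
move=> q0.
exact: (cvg_right_reg (fun y => distr_ge0 L_lin LamE Lam_le y q0) (distr_nd Lam_le q0)).
Qed.

Lemma integrable_poly_itv q (a b : R) :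
  mu.-integrable (`]a, b]%classic : set mR) (fun x => q.[x]%:E).
Proof.
have [ab|ba] := leP a b; last first.
  rewrite (_ : `]a, b]%classic = set0); first exact: integrable_set0.
  by rewrite set_itv_ge// bnd_simp -leNgt ltW.
apply: measurable_bounded_integrable => //.
- by rewrite muE// ltry.
- exact: measurable_poly.
have N0 : 0 <= `|a| + `|b| by rewrite addr_ge0.
have [C C0 qC] := poly_lipschitz q N0.
exists (C * (`|a| + `|b|) + `|q.[0]|); split; first exact: num_real.
move=> M hM x /=; rewrite in_itv /= => /andP[ax xb].
have xN : `|x| <= `|a| + `|b|.
  have := ler_norm b; have := ler_norm (- a); rewrite normrN.
  have := normr_ge0 a; have := normr_ge0 b; rewrite ler_norml => *.
  by apply/andP; split; lra.
apply: le_trans (ltW hM).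
rewrite -[q.[x]](subrK q.[0]) (le_trans (ler_normD _ _))// lerD2r.
by rewrite (le_trans (qC _ _ _ _))// ?normr0// subr0 ler_wpM2l.
Qed.

(** Freezing [q] at the left endpoint costs at most the variation [C (b - a)] times the mass. *)
Lemma integral_poly_local q (C N a b : R) :
  (forall x y, `|x| <= N -> `|y| <= N -> `|q.[x] - q.[y]| <= C * `|x - y|) -> 0 <= C ->
  - N <= a -> a <= b -> b <= N ->
  `|\int[mu]_(x in (`]a, b]%classic : set mR)) q.[x] - q.[a] * (G b - G a)|
    <= C * (b - a) * (G b - G a).
Proof.
move=> qC C0 Na ab bN.
have aN : `|a| <= N by rewrite ler_norml; apply/andP; split; lra.
have mI : measurable (`]a, b]%classic : set mR) by exact: measurable_itv.
have cst (k : R) : \int[mu]_(x in (`]a, b]%classic : set mR)) k = k * (G b - G a).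
  by rewrite Rintegral_cst// muE.
rewrite -(cst q.[a]) -RintegralB//; last 2 first.
- exact: integrable_poly_itv.
- have := integrable_poly_itv (q.[a])%:P a b; apply: eq_integrable => // x _.
  by rewrite hornerC.
have iD : mu.-integrable (`]a, b]%classic : set mR) (EFin \o (fun x => q.[x] - q.[a])).
  have := integrable_poly_itv (q - (q.[a])%:P) a b; apply: eq_integrable => // x _.
  by rewrite /= hornerD hornerN hornerC.
apply: (le_trans (le_normr_Rintegral _ iD)) => //.
rewrite -(cst (C * (b - a))); apply: le_Rintegral => //.
- exact: integrable_norm iD.
- have := integrable_poly_itv (C * (b - a))%:P a b; apply: eq_integrable => // x _.
  by rewrite hornerC.
move=> x /=; rewrite in_itv /= => /andP[ax xb].
have xN : `|x| <= N by rewrite ler_norml; apply/andP; split; lra.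
rewrite (le_trans (qC _ _ xN aN))// ler_wpM2l// ger0_norm ?subr_ge0 ?lerD2r//.
exact: ltW.
Qed.

(** The bound [distr_lip] on ]a + t, b + t] in the limit [t -> 0+]; the strict inequality [b < N]
    leaves room for the shift. *)
Lemma distr_reg_local q (C N a b : R) : (forall x, 0 <= q.[x]) ->
  (forall x y, `|x| <= N -> `|y| <= N -> `|q.[x] - q.[y]| <= C * `|x - y|) -> 0 <= C ->
  - N <= a -> a <= b -> b < N ->
  `|H q b - H q a - q.[a] * (G b - G a)| <= C * (b - a) * (G b - G a).
Proof.
move=> q0 qC C0 Na ab bN.
have aN : `|a| <= N by rewrite ler_norml; apply/andP; split; lra.
have Hb := @cvgH q q0 b; have Ha := @cvgH q q0 a.
have Gb := @cvgH 1 p1_ge0 b; have Ga := @cvgH 1 p1_ge0 a.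
pose lhs t := `|distr Lam q (b + t) - distr Lam q (a + t) -
  q.[a] * (distr Lam 1 (b + t) - distr Lam 1 (a + t))|.
pose rhs t := C * (b - a + t) * (distr Lam 1 (b + t) - distr Lam 1 (a + t)).
have hl : lhs t @[t --> 0^'+] --> `|H q b - H q a - q.[a] * (G b - G a)|.
  apply: cvg_norm; apply: cvgB; first exact: cvgB.
  by apply: cvgMr; exact: cvgB.
have hr : rhs t @[t --> 0^'+] --> C * (b - a) * (G b - G a).
  apply: cvgM; last exact: cvgB.
  apply: cvgMr; rewrite -[X in _ --> X]addr0; apply: cvgD; first exact: cvg_cst.
  by apply: cvg_within_filter; exact: cvg_id.
apply: (ler_cvg_to hl hr); near=> t.
have t0 : 0 < t by near: t; exact: nbhs_right_gt.
have tN : t <= N - b by near: t; apply: nbhs_right_le; rewrite subr_gt0.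
apply: (distr_lip L_lin LamE Lam_lin Lam_le); first by rewrite lerD2r.
move=> x /andP[ax xb].
have xN : `|x| <= N by rewrite ler_norml; apply/andP; split; lra.
rewrite (le_trans (qC _ _ xN aN))// ler_wpM2l// ger0_norm; lra.
Unshelve. all: by end_near. Qed.

(* Both sides are additive functions of the interval that agree with
   [q.[a] * (G b - G a)] on a short interval `]a, b] up to a quadratic error. *)
Lemma integral_poly_itv q (n : nat) : (forall x, 0 <= q.[x]) ->
  \int[mu]_(x in (`]- n%:R, n%:R]%classic : set mR)) q.[x] = H q n%:R - H q (- n%:R).
Proof.
(* One unit beyond [n], so that every subinterval satisfies the strict bound [b < N]. *)
move=> q0; have N0 : 0 <= (n.+1%:R : R) by [].
have [C C0 qC] := poly_lipschitz q N0.
have nn : - n%:R <= n%:R :> R by rewrite (@le_trans _ _ 0)// oppr_le0.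
pose V x := \int[mu]_(x in (`]- n%:R, x]%classic : set mR)) q.[x].
have VB a b : - n%:R <= a -> a <= b ->
    V b - V a = \int[mu]_(x in (`]a, b]%classic : set mR)) q.[x].
  move=> na ab.
  rewrite /V (_ : `]- n%:R, b]%classic = `]- n%:R, a]%classic `|` `]a, b]%classic); last first.
    by rewrite -itv_bndbnd_setU// bnd_simp.
  rewrite Rintegral_setU//; first by rewrite addrC addKr.
    rewrite -itv_bndbnd_setU ?bnd_simp//; exact: integrable_poly_itv.
  by apply/disj_set2P; rewrite -subset0 => x [] /=; rewrite !in_itv /=
    => /andP[_ xa] /andP[ax _]; move: (lt_le_trans ax xa); rewrite ltxx.
have V0 : V (- n%:R) = 0 by rewrite /V set_itv_ge ?Rintegral_set0// bnd_simp ltxx.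
suff : V n%:R - H q n%:R = V (- n%:R) - H q (- n%:R).
  by rewrite V0 sub0r => /eqP; rewrite subr_eq addrC => /eqP.
apply: (@constant_of_small_increments (fun x => V x - H q x) G (2 * C)) => // a b na ab bn.
have nN : (n%:R : R) < n.+1%:R by rewrite ltr_nat.
have Na : - n.+1%:R <= a by lra.
have bN : b < n.+1%:R by lra.
have h1 := integral_poly_local qC C0 Na ab (ltW bN); rewrite -VB// in h1.
have h2 := distr_reg_local q0 qC C0 Na ab bN.
have -> : V b - H q b - (V a - H q a) = (V b - V a - q.[a] * (G b - G a)) -
  (H q b - H q a - q.[a] * (G b - G a)) by ring.
rewrite (le_trans (ler_normB _ _))// (le_trans (lerD h1 h2))//.
by have -> : 2 * C * (b - a) * (G b - G a) =
  C * (b - a) * (G b - G a) + C * (b - a) * (G b - G a) by ring.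
Qed.

(** [H q x] lies between [distr Lam q] at [x] and at [x + 1], which reduces the claim to Chebyshev's
    estimate with [r = n - 1]. *)
Lemma cvg_distr_reg q : (forall x, 0 <= q.[x]) ->
  H q n%:R - H q (- n%:R) @[n --> \oo] --> L q.
Proof.
move=> q0; have nd := distr_nd Lam_le q0.
have d0 y := distr_ge0 L_lin LamE Lam_le y q0.
have lo n : (1 < n)%N -> L q - L (q * 'X ^+ 2) / (n%:R - 1) ^+ 2 <= H q n%:R - H q (- n%:R) <= L q.
  move=> n1; have n1' : (1 : R) < n%:R by rewrite ltr1n.
  have h1 : H q (- n%:R) <= distr Lam q (1 - n%:R) by apply: right_reg_le => //; lra.
  have h2 : distr Lam q n%:R <= H q n%:R by exact: le_right_reg.
  have h3 : H q n%:R <= distr Lam q (n%:R + 1) by apply: right_reg_le => //; lra.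
  have h4 : distr Lam q (- n%:R) <= H q (- n%:R) by exact: le_right_reg.
  have r0 : 0 < n%:R - 1 :> R by lra.
  have e1 : 1 - n%:R <= - (n%:R - 1) :> R by lra.
  have e2 : n%:R - 1 <= n%:R :> R by lra.
  have e3 : - n%:R <= - (n%:R - 1) :> R by lra.
  have e4 : n%:R - 1 <= n%:R + 1 :> R by lra.
  have /andP[k1 _] := distr_tail L_lin LamE Lam_lin Lam_le q0 e1 e2 r0.
  have /andP[_ k2] := distr_tail L_lin LamE Lam_lin Lam_le q0 e3 e4 r0.
  by apply/andP; split; lra.
pose K := L (q * 'X ^+ 2).
apply: (@squeeze_cvgr _ _ _ _ (fun n : nat => L q - K * ((n%:R - 1) ^+ 2)^-1) (fun=> L q)).
- near=> n; apply: lo; near: n; exact: nbhs_infty_gt.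
- rewrite -[X in _ --> X]subr0; apply: cvgB; first exact: cvg_cst.
  rewrite -(mulr0 K); apply: cvgMr.
  apply/gtr0_cvgV0.
    near=> n; rewrite exprn_gt0// subr_gt0 ltr1n; near: n; exact: nbhs_infty_gt.
  apply/cvgryPgt => A.
  near=> n; rewrite (@lt_le_trans _ _ (n%:R - 1))//.
    rewrite ltrBrDl; near: n; exact: nbhs_infty_gtr.
  rewrite expr2 ler_peMr//.
    by rewrite subr_ge0 ler1n; near: n; exact: nbhs_infty_ge.
  rewrite lerBrDl -(natrD _ 1 1) ler_nat; near: n; exact: nbhs_infty_ge.
- exact: cvg_cst.
Unshelve. all: by end_near. Qed.

Lemma ge0_integral_poly q : (forall x, 0 <= q.[x]) -> (\int[mu]_x q.[x]%:E = (L q)%:E)%E.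
Proof.
move=> q0.
pose I (n : nat) : set mR := `]- n%:R, n%:R]%classic.
have mI n : measurable (I n) by exact: measurable_itv.
have h : (\int[mu]_(x in I n) q.[x]%:E)%E @[n --> \oo] -->
    (\int[mu]_(x in \bigcup_n I n) q.[x]%:E)%E.
  apply: ge0_nondecreasing_set_cvg_integral => //.
  - by move=> m n mn; apply/subsetPset/subset_itv; rewrite leBSide/= ?lerN2 ler_nat.
  - by move=> n; apply/measurable_EFinP; exact: measurable_poly.
  - by move=> n x _; rewrite lee_fin.
rewrite (bigcup_itvT false false) in h.
apply: (cvg_unique _ h) => //.
apply: cvg_trans (_ : (fun n => (H q n%:R - H q (- n%:R))%:E) @ \oo --> (L q)%:E).
  apply: near_eq_cvg; near=> n.
  rewrite -integral_poly_itv// /Rintegral fineK//.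
  exact: integrable_fin_num (integrable_poly_itv _ _ _).
by apply/cvg_EFin; [near=> n|exact: cvg_distr_reg].
Unshelve. all: by end_near. Qed.

End MomentMeasure.

Theorem hamburger (L : {poly R} -> R) :
  (forall p q (a : R), L (p + a *: q) = L p + a * L q) -> (forall q, 0 <= L (q ^+ 2)) ->
  exists mu : {finite_measure set mR -> \bar R}, forall q,
    mu.-integrable setT (fun x => q.[x]%:E) /\ \int[mu]_x q.[x] = L q.
Proof.
move=> L_lin L_sqr.
have [Lam [LamE Lam_lin Lam_le]] := functional_extension L_lin L_sqr.
have p1_ge0 x : (0 : R) <= (1 : {poly R}).[x] by rewrite hornerC.
pose G := right_reg_cumulative
  (fun y => distr_ge0 L_lin LamE Lam_le y p1_ge0) (distr_nd Lam_le p1_ge0).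
pose nu : {measure set mR -> \bar R} := lebesgue_stieltjes_measure G.
have nuE a b : a <= b -> nu (`]a, b]%classic : set mR) = (G b - G a)%:E.
  exact: lebesgue_stieltjes_ocitv.
have nuint := ge0_integral_poly L_lin LamE Lam_lin Lam_le nuE.
have nuT : (nu setT = (L 1)%:E)%E.
  rewrite -nuint//; under eq_integral do rewrite hornerC.
  by rewrite integral_cst// mul1e.
have finnu : fin_num_fun nu.
  move=> A mA; rewrite ge0_fin_numE// (@le_lt_trans _ _ (nu setT))//.
    by apply: le_measure; rewrite ?inE.
  by rewrite nuT ltry.
pose mu : {finite_measure set mR -> \bar R} :=
  HB.pack (lebesgue_stieltjes_measure G)
    (Measure_isFinite.Build _ _ _ (lebesgue_stieltjes_measure G) finnu).
exists mu => q.
have ip p : (forall x, 0 <= p.[x]) -> nu.-integrable setT (fun x => p.[x]%:E).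
  move=> p0; apply/integrableP; split.
    by apply/measurable_EFinP; exact: measurable_poly.
  by under eq_integral do rewrite gee0_abs ?lee_fin//; rewrite nuint// ltry.
(* Any [q] is the difference of the nonnegative polynomials [1 + q^2] and [1 + q^2 - q]. *)
pose u := 1 + q ^+ 2.
have u0 x : 0 <= u.[x] by apply: le_trans (horner_le_sqr q x).
have v0 x : 0 <= (u - q).[x].
  by rewrite hornerD hornerN subr_ge0 (le_trans (ler_norm _))// horner_le_sqr.
have qE x : q.[x] = u.[x] - (u - q).[x] by rewrite [(u - q).[x]]hornerD hornerN; ring.
have iq : nu.-integrable setT (fun x => q.[x]%:E).
  have := integrableB measurableT (ip u u0) (ip (u - q) v0).
  by apply: eq_integrable => // x _; rewrite [in RHS]qE.
split => //.
rewrite (_ : \int[mu]_x q.[x] = \int[nu]_x (u.[x] - (u - q).[x])); last first.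
  by apply: eq_Rintegral => x _; rewrite -qE.
rewrite RintegralB//; [|exact: ip..].
have LB : L (u - q) = L u - L q by rewrite -scaleN1r L_lin mulN1r.
by rewrite /Rintegral !nuint//= LB; ring.
Qed.

End Hamburger.

(** * The Laplace transform *)

Section ComplexExponential.
Variable R : realType.
Local Notation C := R[i].
Local Notation normc := ComplexField.Normc.normc.
Implicit Types (u v w z : C) (a b x : R).

Lemma cexpD u v : cexp (u + v) = cexp u * cexp v.
Proof.
case: u v => a b [c d]; rewrite /cexp /= expRD cosD sinD.
by apply/eqP; rewrite eq_complex /=; apply/andP; split; apply/eqP; ring.
Qed.

Lemma normc_cexp w : normc (cexp w) = expR (complex.Re w).
Proof.
case: w => a b /=; rewrite !exprMn -mulrDr cos2Dsin2 mulr1 sqrtr_sqr.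
by rewrite ger0_norm// expR_ge0.
Qed.

(** Mean value theorem: [sin x = cos c * x], and [1 - cos c = 2 sin (c/2)^2 <= c] by using
    [|sin| <= 1] on one of the two factors. *)
Lemma sin_le_ge0 x : 0 <= x -> `|sin x| <= x /\ `|sin x - x| <= x ^+ 2.
Proof.
have lip (y : R) : 0 <= y -> exists2 c : R, 0 <= c <= y & sin y = cos c * y.
  rewrite le_eqVlt => /predU1P[<-|y0]; first by exists 0; rewrite ?lexx// mulr0 sin0.
  have ds t : t \in `]0, y[ -> is_derive t 1 (@sin R) (cos t) by move=> _; exact: is_derive_sin.
  have cs : {within `[0, y], continuous (@sin R)}.
    by apply: continuous_subspaceT => t; exact: continuous_sin.
  have [c cy h] := MVT y0 ds cs.
  exists c; first by move: cy; rewrite in_itv /= => /andP[/ltW -> /ltW ->].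
  by move: h; rewrite sin0 !subr0.
have sle (y : R) : 0 <= y -> `|sin y| <= y.
  move=> y0; have [c _ ->] := lip _ y0.
  by rewrite normrM (ger0_norm y0) ler_piMl// cos_max.
move=> x0; split; first exact: sle.
have [c /andP[c0 cx] ->] := lip _ x0.
have -> : cos c * x - x = (cos c - 1) * x by ring.
rewrite normrM (ger0_norm x0) expr2 ler_wpM2r//.
have -> : cos c - 1 = - 2 * sin (c / 2) ^+ 2.
  by rewrite {1}[c](splitr c) -mulr2n cos_mulr2n cos2sin2 -mulr_natr; ring.
have c2 : 0 <= c / 2 by rewrite divr_ge0.
have := sle _ c2; have := sin_max (c / 2) => s1 s2.
rewrite normrM normrN normr_nat normrX expr2.
have : `|sin (c / 2)| * `|sin (c / 2)| <= (c / 2) * 1 by rewrite ler_pM.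
by lra.
Qed.

Lemma sin_le x : `|sin x| <= `|x| /\ `|sin x - x| <= x ^+ 2.
Proof.
have [x0|x0] := leP 0 x; first by rewrite (ger0_norm x0); exact: sin_le_ge0.
have nx : 0 <= - x by rewrite oppr_ge0 ltW.
have [h1 h2] := sin_le_ge0 nx; rewrite (ltr0_norm x0); split.
  by move: h1; rewrite sinN normrN.
by move: h2; rewrite sinN sqrrN -opprD normrN.
Qed.

Lemma cos_le x : `|cos x - 1| <= x ^+ 2.
Proof.
have -> : cos x - 1 = - 2 * sin (x / 2) ^+ 2.
  by rewrite {1}[x](splitr x) -mulr2n cos_mulr2n cos2sin2 -mulr_natr; ring.
rewrite normrM normrN normr_nat normrX.
have [+ _] := sin_le (x / 2) => h.
have : `|sin (x / 2)| ^+ 2 <= `|x / 2| ^+ 2 by rewrite lerXn2r ?nnegrE.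
by rewrite [leRHS]real_normK ?num_real//; nra.
Qed.

(** From [1 + a <= expR a], used also at [- a] in the form [expR a - 1 <= a * expR a]. *)
Lemma expR_sub1_le a : `|expR a - 1| <= `|a| * expR `|a|.
Proof.
have h1 := expR_ge1Dx a; have := expR_ge1Dx (- a).
rewrite expRN -(ler_pM2l (expR_gt0 a)) divff ?gt_eqF ?expR_gt0// => h2.
have [a0|a0] := leP 0 a.
  by rewrite (ger0_norm a0) ger0_norm; [nra|lra].
rewrite (ltr0_norm a0) ltr0_norm; last by rewrite subr_lt0 -expR0 ltr_expR.
have : 1 <= expR (- a) by rewrite -expR0 ler_expR; lra.
by move: (expR (- a)) => e e1; nra.
Qed.

Lemma expR_sub1D_le a : `|expR a - 1 - a| <= a ^+ 2 * expR `|a|.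
Proof.
have h1 := expR_ge1Dx a; have := expR_ge1Dx (- a).
rewrite expRN -(ler_pM2l (expR_gt0 a)) divff ?gt_eqF ?expR_gt0// => h2.
have h3 := expR_sub1_le a.
rewrite ger0_norm; last lra.
have : expR a - 1 - a <= a * (expR a - 1) by nra.
move=> /le_trans; apply; apply: (le_trans (ler_norm _)); rewrite normrM.
by rewrite expr2 -normrM -[a * a]ger0_norm ?normrM -?mulrA ?ler_wpM2l// -expr2 sqr_ge0.
Qed.

(** Both parts are split into an exponential and a trigonometric error. With [N = |w|], the real
    part contributes [N^2 exp N] and the imaginary part [2 N^2 exp N]; hence the constant 3. *)
Lemma cexp_taylor2 w : normc (cexp w - 1 - w) <= 3 * normc w ^+ 2 * expR (normc w).
Proof.
have aw := normc_Re w; have bw := normc_Im w.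
have ww : normc w ^+ 2 = complex.Re w ^+ 2 + complex.Im w ^+ 2.
  by case: w {aw bw} => a b /=; rewrite sqr_sqrtr// addr_ge0 ?sqr_ge0.
set N := normc w in aw bw ww *.
case: w @N aw bw ww => a b /= aw bw ww; set N := Num.sqrt _ in aw bw ww *.
have eN : expR `|a| <= expR N by rewrite ler_expR.
have eN1 : 1 <= expR N by rewrite -expR0 ler_expR (le_trans _ aw).
have ea : expR a <= expR N by rewrite ler_expR (le_trans (ler_norm a)).
have triangle (c d : R) : Num.sqrt (c ^+ 2 + d ^+ 2) <= `|c| + `|d|.
  rewrite -[leRHS]ger0_norm ?addr_ge0// -sqrtr_sqr ler_wsqrtr//.
  by rewrite sqrrD !real_normK ?num_real// -addrA lerD2l lerDr mulrn_wge0// mulr_ge0.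
apply: (le_trans (triangle _ _)).
have [hs hs2] := sin_le b; have hc := cos_le b.
have h1 := expR_sub1_le a; have h2 := expR_sub1D_le a.
have re : `|expR a * cos b - 1 - a| <= N ^+ 2 * expR N.
  have -> : expR a * cos b - 1 - a = (expR a - 1 - a) + expR a * (cos b - 1) by ring.
  rewrite (le_trans (ler_normD _ _))// ww mulrDl lerD//.
    by rewrite (le_trans h2)// ler_wpM2l// sqr_ge0.
  by rewrite normrM mulrC (ger0_norm (expR_ge0 _)) ler_pM// expR_ge0.
have im : `|expR a * sin b - 0 - b| <= 2 * (N ^+ 2 * expR N).
  have -> : expR a * sin b - 0 - b = (expR a - 1) * sin b + (sin b - b) by ring.
  rewrite (le_trans (ler_normD _ _))// mulr_natl mulr2n lerD//.
    rewrite normrM expr2 [N * N * _]mulrAC ler_pM ?mulr_ge0//; last exact: le_trans bw.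
    by rewrite (le_trans h1)// ler_pM// expR_ge0.
  rewrite (le_trans hs2)// (@le_trans _ _ (N ^+ 2))//.
    by rewrite ww lerDr sqr_ge0.
  by rewrite ler_peMr// sqr_ge0.
have -> : 3 * N ^+ 2 * expR N = N ^+ 2 * expR N + 2 * (N ^+ 2 * expR N) by ring.
exact: lerD.
Qed.

End ComplexExponential.

(** * Integrals of complex-valued functions *)

Section ComplexIntegralTheory.
Context d (T : measurableType d) (R : realType) (mu : {measure set T -> \bar R}).
Local Notation C := R[i].
Local Notation normc := ComplexField.Normc.normc.
Implicit Types (f h : T -> C) (g : T -> R).

Lemma cintegrable_dominated f g :
  measurable_fun setT (fun x => complex.Re (f x)) ->
  measurable_fun setT (fun x => complex.Im (f x)) ->
  (forall x, normc (f x) <= g x) -> mu.-integrable setT (fun x => (g x)%:E) ->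
  cintegrable mu f.
Proof.
move=> mRe mIm fg ig; split; apply: le_integrable ig => //;
  do ?exact/measurable_EFinP; move=> x _;
  rewrite lee_fin; apply: le_trans (ler_norm _); apply: le_trans (fg x).
- exact: normc_Re.
- exact: normc_Im.
Qed.

Let integrableDE g1 g2 : mu.-integrable setT (fun x => (g1 x)%:E) ->
  mu.-integrable setT (fun x => (g2 x)%:E) -> mu.-integrable setT (fun x => (g1 x + g2 x)%:E).
Proof. by move=> h1 h2; apply: eq_integrable (integrableD measurableT h1 h2). Qed.

Let integrableZE (k : R) g : mu.-integrable setT (fun x => (g x)%:E) ->
  mu.-integrable setT (fun x => (k * g x)%:E).
Proof. by move=> hg; apply: eq_integrable (integrableZl measurableT k hg). Qed.

Lemma cintegrableD f h : cintegrable mu f -> cintegrable mu h ->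
  cintegrable mu (fun x => f x + h x) /\
  cintegral mu (fun x => f x + h x) = cintegral mu f + cintegral mu h.
Proof.
move=> [fr fi] [hr hi].
have re : (fun x => complex.Re (f x + h x)) = (fun x => complex.Re (f x) + complex.Re (h x)).
  by apply/funext => x; case: (f x) (h x) => ? ? [].
have im : (fun x => complex.Im (f x + h x)) = (fun x => complex.Im (f x) + complex.Im (h x)).
  by apply/funext => x; case: (f x) (h x) => ? ? [].
split.
- split.
  + rewrite (_ : (fun x => _) = EFin \o (fun x => complex.Re (f x + h x)))// re.
    exact: integrableDE.
  + rewrite (_ : (fun x => _) = EFin \o (fun x => complex.Im (f x + h x)))// im.
    exact: integrableDE.
- by rewrite /cintegral re im !RintegralD.
Qed.

Lemma cintegrableZ (c : C) f : cintegrable mu f ->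
  cintegrable mu (fun x => c * f x) /\
  cintegral mu (fun x => c * f x) = c * cintegral mu f.
Proof.
case: c => a b [fr fi].
have re : (fun x => complex.Re ((a +i* b) * f x)) =
    (fun x => a * complex.Re (f x) - b * complex.Im (f x)).
  by apply/funext => x; case: (f x).
have im : (fun x => complex.Im ((a +i* b) * f x)) =
    (fun x => a * complex.Im (f x) + b * complex.Re (f x)).
  by apply/funext => x; case: (f x).
have ia := integrableZE a fr; have ib := integrableZE b fi.
have ic := integrableZE a fi; have id := integrableZE b fr.
have iN := integrableZE (- 1) ib.
have re' : (fun x => a * complex.Re (f x) - b * complex.Im (f x)) =
  (fun x => a * complex.Re (f x) + -1 * (b * complex.Im (f x))).
  by apply/funext => x; rewrite mulN1r.
split.
- split.
  + rewrite (_ : (fun x => _) = EFin \o (fun x => complex.Re ((a +i* b) * f x)))// re re'.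
    exact: integrableDE.
  + rewrite (_ : (fun x => _) = EFin \o (fun x => complex.Im ((a +i* b) * f x)))// im.
    exact: integrableDE.
- by rewrite /cintegral re im RintegralB// RintegralD// !RintegralZl.
Qed.

Lemma cintegrableB f h : cintegrable mu f -> cintegrable mu h ->
  cintegrable mu (fun x => f x - h x) /\
  cintegral mu (fun x => f x - h x) = cintegral mu f - cintegral mu h.
Proof.
move=> cf ch; have [cNh hE] := cintegrableZ (-1) ch.
have -> : (fun x => f x - h x) = (fun x => f x + -1 * h x).
  by apply/funext => x; rewrite mulN1r.
by have [? ->] := cintegrableD cf cNh; rewrite hE mulN1r.
Qed.

Lemma cintegrable_sum (I : Type) (s : seq I) (c : I -> C) (f : I -> T -> C) :
  (forall i, cintegrable mu (f i)) ->
  cintegrable mu (fun x => \sum_(i <- s) c i * f i x) /\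
  cintegral mu (fun x => \sum_(i <- s) c i * f i x) = \sum_(i <- s) c i * cintegral mu (f i).
Proof.
move=> cf; elim: s => [|i s [IH1 IH2]].
  under eq_fun do rewrite big_nil; rewrite big_nil.
  split; first by split; exact: integrable0.
  by rewrite /cintegral /= Rintegral_cst// mul0r.
under eq_fun do rewrite big_cons; rewrite big_cons.
have [cZ ZE] := cintegrableZ (c i) (cf i).
by have [? ->] := cintegrableD cZ IH1; rewrite ZE IH2.
Qed.

(** Real and imaginary parts are bounded separately, which costs the factor 2. *)
Lemma normc_cintegral f g : cintegrable mu f ->
  mu.-integrable setT (fun x => (g x)%:E) -> (forall x, normc (f x) <= g x) ->
  normc (cintegral mu f) <= 2 * \int[mu]_x g x.
Proof.
move=> [fr fi] ig fg; rewrite /cintegral.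
have le (h : T -> R) : mu.-integrable setT (EFin \o h) -> (forall x, `|h x| <= g x) ->
    `|\int[mu]_x h x| <= \int[mu]_x g x.
  move=> ih hg; apply: (le_trans (le_normr_Rintegral _ ih)) => //.
  by apply: le_Rintegral => //; exact: integrable_norm ih.
have := le _ fr (fun x => le_trans (normc_Re _) (fg x)).
have := le _ fi (fun x => le_trans (normc_Im _) (fg x)).
move: (\int[mu]_x complex.Re (f x)) (\int[mu]_x complex.Im (f x)) => a b /= bg ag.
have g0 : 0 <= \int[mu]_x g x by exact: le_trans bg.
rewrite -[leRHS]ger0_norm ?mulr_ge0// -sqrtr_sqr ler_wsqrtr//.
have : `|a| ^+ 2 <= (\int[mu]_x g x) ^+ 2 by rewrite lerXn2r ?nnegrE.
have : `|b| ^+ 2 <= (\int[mu]_x g x) ^+ 2 by rewrite lerXn2r ?nnegrE.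
by rewrite !real_normK ?num_real//; nra.
Qed.

End ComplexIntegralTheory.

(** * Exponential moments and holomorphy of the Laplace transform *)

Section Laplace.
Variable R : realType.
Local Notation C := R[i].
Local Notation normc := ComplexField.Normc.normc.
Local Notation mR := (measurableTypeR R).
Variable mu : {finite_measure set mR -> \bar R}.

Definition exp_integrable (r : R) : Prop :=
  mu.-integrable (setT : set mR) (fun x => (expR (r * `|x|))%:E).

Lemma exp_integrableZ (r c : R) : exp_integrable r ->
  mu.-integrable (setT : set mR) (fun x => (c * expR (r * `|x|))%:E).
Proof. by move=> h; apply: eq_integrable (integrableZl measurableT c h). Qed.

Lemma normc_real_mul (x : R) (z : C) : normc (x%:C * z) = `|x| * normc z.
Proof.
by rewrite ComplexField.Normc.normcM /= expr0n addr0 sqrtr_sqr.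
Qed.

Lemma normc_cexp_le (x : R) (z : C) : normc (cexp (x%:C * z)) <= expR (`|x| * normc z).
Proof.
rewrite normc_cexp ler_expR mulrC ReM_real mulrC (le_trans (ler_norm _))//.
by rewrite normrM ler_wpM2l// normc_Re.
Qed.

Lemma measurable_cexp (z : C) :
  measurable_fun (setT : set mR) (fun x : R => complex.Re (cexp (x%:C * z))) /\
  measurable_fun (setT : set mR) (fun x : R => complex.Im (cexp (x%:C * z))).
Proof.
have re (x : R) : complex.Re (x%:C * z) = x * complex.Re z by rewrite mulrC ReM_real mulrC.
have im (x : R) : complex.Im (x%:C * z) = x * complex.Im z by rewrite mulrC ImM_real mulrC.
have mM (c : R) : measurable_fun (setT : set R) (fun x : R => x * c).
  by apply: measurable_funM => //; exact: measurable_cst.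
have me : measurable_fun (setT : set R) (fun x : R => expR (x * complex.Re z)).
  by apply: measurableT_comp => //; exact: measurable_expR.
have mc : measurable_fun (setT : set R) (fun x : R => cos (x * complex.Im z)).
  by apply: measurableT_comp => //; apply: continuous_measurable_fun; exact: continuous_cos.
have ms : measurable_fun (setT : set R) (fun x : R => sin (x * complex.Im z)).
  by apply: measurableT_comp => //; apply: continuous_measurable_fun; exact: continuous_sin.
rewrite /cexp /=; split.
- by under eq_fun do rewrite re im; exact: measurable_funM.
- by under eq_fun do rewrite re im; exact: measurable_funM.
Qed.

Lemma cintegrable_cexp (r : R) (z : C) : exp_integrable r -> normc z <= r ->
  cintegrable mu (fun x : R => cexp (x%:C * z)).
Proof.
move=> ir zr; have [mr mi] := measurable_cexp z.
apply: cintegrable_dominated ir => // x.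
by rewrite (le_trans (normc_cexp_le _ _))// ler_expR mulrC ler_wpM2r.
Qed.

(** Half of the exponent absorbs the factor [x], since [|x| <= (2 / r) * expR (r / 2 * |x|)]. *)
Lemma cintegrable_Xcexp (r : R) (z : C) : 0 < r -> exp_integrable r -> normc z <= r / 2 ->
  cintegrable mu (fun x : R => x%:C * cexp (x%:C * z)).
Proof.
move=> r0 ir zr; have [mr mi] := measurable_cexp z.
have mid : measurable_fun (setT : set mR) (fun x : R => x) by [].
apply: cintegrable_dominated (exp_integrableZ (2 / r) ir).
- under eq_fun do rewrite mulrC ReM_real; exact: measurable_funM.
- under eq_fun do rewrite mulrC ImM_real; exact: measurable_funM.
- move=> x; rewrite normc_real_mul.
  have -> : r * `|x| = r / 2 * `|x| + r / 2 * `|x| by field.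
  rewrite expRD mulrA; apply: ler_pM => //.
  + by case: (cexp _) => a b /=; rewrite sqrtr_ge0.
  + rewrite -ler_pdivrMl ?divr_gt0// invf_div.
    by rewrite (le_trans _ (expR_ge1Dx _))// lerDr.
  + by rewrite (le_trans (normc_cexp_le _ _))// ler_expR mulrC ler_wpM2r.
Qed.

(** Differentiation under the integral: the Taylor remainder in [h] is quadratic, with a factor
    [x^2] and two exponentials. For [z] and [h] within [r / 4], half of the exponent [r |x|] pays
    for the exponentials and the other half for [x^2]. *)
Lemma laplace_derivable (r : R) (z : C) : 0 < r -> exp_integrable r -> normc z <= r / 4 ->
  derivable (laplace mu) z 1.
Proof.
move=> r0 ir zr.
have iX := cintegrable_Xcexp r0 ir (le_trans zr (_ : r / 4 <= r / 2)).
have {}iX : cintegrable mu (fun x : R => x%:C * cexp (x%:C * z)) by apply: iX; lra.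
pose D := cintegral mu (fun x : R => x%:C * cexp (x%:C * z)).
(* The 3 of the Taylor bound times the 8 of [x^2 <= 8 / r^2 * expR (r / 2 * |x|)]. *)
pose K := 24 / r ^+ 2.
pose E := \int[mu]_(x in (setT : set mR)) (expR (r * `|x|)).
have E0 : 0 <= E by apply: Rintegral_ge0 => x _; exact: expR_ge0.
have K0 : 0 <= K by rewrite divr_ge0// sqr_ge0.
have est (h : C) : normc h <= r / 4 ->
    normc (laplace mu (h + z) - laplace mu z - h * D) <= 2 * (K * normc h ^+ 2 * E).
  move=> hr.
  have hz : normc (h + z) <= r.
    by rewrite (le_trans (le_normcD _ _))// (le_trans (lerD hr zr))//; lra.
  have i1 := cintegrable_cexp ir hz.
  have i2 := cintegrable_cexp (z := z) ir (le_trans zr (_ : r / 4 <= r)).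
  have {}i2 : cintegrable mu (fun x : R => cexp (x%:C * z)) by apply: i2; lra.
  have [i3 e3] := cintegrableZ h iX.
  have [i4 e4] := cintegrableB i1 i2.
  have [i5 e5] := cintegrableB i4 i3.
  rewrite /laplace -e4 -e3 -e5 /E -RintegralZl//.
  apply: normc_cintegral => //; first exact: exp_integrableZ.
  move=> x.
  have -> : cexp (x%:C * (h + z)) - cexp (x%:C * z) - h * (x%:C * cexp (x%:C * z)) =
     (cexp (x%:C * h) - 1 - x%:C * h) * cexp (x%:C * z).
    by rewrite mulrDr cexpD; ring.
  rewrite ComplexField.Normc.normcM.
  have n0 : 0 <= `|x| * normc h.
    by rewrite mulr_ge0//; case: (h) => a b /=; rewrite sqrtr_ge0.
  have cn0 (w : C) : 0 <= normc w by case: (w) => a b /=; rewrite sqrtr_ge0.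
  have t1 := cexp_taylor2 (x%:C * h); rewrite normc_real_mul in t1.
  have t2 := normc_cexp_le x z.
  rewrite (le_trans (ler_pM (cn0 _) (cn0 _) t1 t2))//.
  have q : `|x| ^+ 2 <= 8 / r ^+ 2 * expR (r / 2 * `|x|).
    have := @expR_ge1Dxn R (r / 2 * `|x|) 1 _.
    have p0 : 0 <= r / 2 * `|x| by rewrite mulr_ge0// divr_ge0// ltW.
    move=> /(_ p0) /(le_trans _) hle.
    have : (r / 2 * `|x|) ^+ 2 / 2`!%:R <= expR (r / 2 * `|x|).
      by apply: le_trans (expR_ge1Dxn 1 p0); rewrite lerDr.
    rewrite -(ler_pM2l (_ : 0 < 8 / r ^+ 2)) ?divr_gt0 ?exprn_gt0//.
    move=> /(le_trans _); apply; rewrite le_eqVlt; apply/orP; left; apply/eqP.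
    by rewrite (_ : 2`! = 2)//; field; rewrite gt_eqF.
  have e : expR (`|x| * normc h) * expR (`|x| * normc z) <= expR (r / 2 * `|x|).
    by rewrite -expRD ler_expR -mulrDr mulrC ler_wpM2r//; lra.
  have -> : K * normc h ^+ 2 * expR (r * `|x|) =
     3 * normc h ^+ 2 * ((8 / r ^+ 2 * expR (r / 2 * `|x|)) * expR (r / 2 * `|x|)).
    have -> : r * `|x| = r / 2 * `|x| + r / 2 * `|x| by field.
    by rewrite expRD /K; field; rewrite gt_eqF.
  have -> : 3 * (`|x| * normc h) ^+ 2 * expR (`|x| * normc h) * expR (`|x| * normc z) =
     3 * normc h ^+ 2 * (`|x| ^+ 2 * (expR (`|x| * normc h) * expR (`|x| * normc z))).
    by ring.
  rewrite ler_wpM2l ?mulr_ge0 ?sqr_ge0//.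
  by rewrite ler_pM// ?sqr_ge0// mulr_ge0// expR_ge0.
apply/cvg_ex; exists D; apply/cvgrPdist_le => e e0.
have [e' e'0 e'e] : exists2 e' : R, 0 < e' & e'%:C = e.
  by move: e0; case: (e) => x y; rewrite ltcE/= => /andP[/eqP -> x0]; exists x.
pose B := 2 * (K * E) + 1.
have B0 : 0 < B by rewrite ltr_wpDl// mulr_ge0// mulr_ge0.
pose del := Num.min (r / 4) (e' / B).
have del0 : 0 < del by rewrite lt_min !divr_gt0.
rewrite /= /dnbhs /within /=; apply/nbhs_ballP; exists del%:C; first by rewrite /= ltcR.
move=> h; rewrite -ball_normE /= sub0r normrN normcE ltcR => hdel h0.
have hr : normc h <= r / 4 by rewrite (le_trans (ltW hdel))// ge_min lexx.
have he : normc h <= e' / B by rewrite (le_trans (ltW hdel))// ge_min lexx orbT.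
have hE := est h hr.
rewrite -e'e normcE lecR /GRing.scale /= mulr1.
have -> : D - h^-1 * (laplace mu (h + z) - laplace mu z) =
   - (h^-1 * (laplace mu (h + z) - laplace mu z - h * D)) by field.
have nh0 : 0 < normc h by move: h0; rewrite -normr_gt0 normcE ltcR.
rewrite normcN ComplexField.Normc.normcM ComplexField.Normc.normcV ler_pdivrMl//.
rewrite (le_trans hE)//.
have -> : 2 * (K * normc h ^+ 2 * E) = normc h * (2 * (K * E) * normc h) by ring.
rewrite ler_wpM2l ?(ltW nh0)// (@le_trans _ _ (B * normc h))//.
  by rewrite ler_wpM2r ?(ltW nh0)// lerDl.
by rewrite mulrC -ler_pdivlMr.
Qed.

Lemma exp_integrable_analytic (r : R) : 0 < r -> exp_integrable r -> analytic_measure mu.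
Proof.
move=> r0 ir.
have near0 : \forall z \near (0 : C), normc z <= r / 4.
  apply/nbhs_ballP; exists (r / 4)%:C; first by rewrite /= ltcR divr_gt0.
  by move=> z; rewrite -ball_normE /= sub0r normrN normcE ltcR => /ltW.
split.
  apply: filterS near0 => z zr; apply: (cintegrable_cexp ir).
  by rewrite (le_trans zr)//; lra.
by apply: filterS near0 => z zr; exact: laplace_derivable ir zr.
Qed.

(** [expR (r * |x|)] is at most [expR (r * x) + expR (- (r * x))], so integrability at the two real
    points [r] and [- r] of the neighborhood suffices. *)
Lemma analytic_exp_integrable : analytic_measure mu -> exists2 r : R, 0 < r & exp_integrable r.
Proof.
move=> [ic _].
have icN : \forall z \near (0 : C), cintegrable mu (fun x : R => cexp (x%:C * - z)).
  have : (fun z : C => - z) @ (0 : C) --> - (0 : C) by exact: opp_continuous.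
  by rewrite oppr0 => h; exact: (h _ ic).
have h1 := near_real_complex ic; have h2 := near_real_complex icN.
have [r [r0 [i1 _] [i2 _]]] : exists r : R, [/\ 0 < r,
    cintegrable mu (fun x : R => cexp (x%:C * r%:C)) &
    cintegrable mu (fun x : R => cexp (x%:C * - r%:C))].
  near (0 : R)^'+ => r; exists r; split.
  - by near: r; exact: nbhs_right_gt.
  - by near: r.
  - by near: r.
exists r => //.
have re (x : R) : complex.Re (cexp (x%:C * r%:C)) = expR (r * x).
  by rewrite /cexp ReM_real ImM_real /= mul0r cos0 mulr1 mulrC.
have reN (x : R) : complex.Re (cexp (x%:C * - r%:C)) = expR (- (r * x)).
  by rewrite /cexp -rmorphN ReM_real ImM_real /= mul0r cos0 mulr1 mulrN mulrC.
have iS := integrableD measurableT i1 i2.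
apply: le_integrable iS => //.
  apply/measurable_EFinP; apply: measurableT_comp; first exact: measurable_expR.
  by apply: measurable_funM => //; exact: measurableT_comp.
move=> x _; rewrite re reN -EFinD !abse_EFin lee_fin.
rewrite ger0_norm ?expR_ge0// ger0_norm ?addr_ge0 ?expR_ge0//.
have [x0|x0] := leP 0 x; first by rewrite ger0_norm// lerDl expR_ge0.
by rewrite ltr0_norm// mulrN lerDr expR_ge0.
Unshelve. all: by end_near. Qed.

(** The partial sums of [expR (r * x) + expR (- (r * x))] contain even powers only, so they are
    nonnegative and increasing, and their integrals involve only the moments that are bounded by
    assumption. As [(m!)^2 <= (2m)!], a geometric series bounds these integrals, and monotone
    convergence concludes. *)
Lemma moment_exp_integrable (M K : R) : 0 <= M -> 0 < K ->
  (forall p : {poly R}, mu.-integrable (setT : set mR) (fun x => p.[x]%:E)) ->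
  (forall n, \int[mu]_(x in (setT : set mR)) ('X^n ^+ 2).[x] <= (M * n`!%:R * K ^+ n) ^+ 2) ->
  exists2 r : R, 0 < r & exp_integrable r.
Proof.
(* Makes [r * K = 1/2], the ratio of the geometric series. *)
move=> M0 K0 ip mb; pose r := (2 * K)^-1.
have r0 : 0 < r by rewrite invr_gt0 mulr_gt0.
exists r => //.
pose c k := (r ^+ k + (- r) ^+ k) / k`!%:R.
pose q n : {poly R} := \sum_(k < n) c k *: 'X^k.
have codd k : odd k -> c k = 0.
  by move=> ok; rewrite /c exprNn -signr_odd ok expr1 mulN1r subrr mul0r.
have ceven k : c k.*2 = 2 * r ^+ k.*2 / (k.*2)`!%:R.
  by rewrite /c exprNn -signr_odd odd_double expr0 mul1r -mulr2n mulr_natl.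
have term0 k x : 0 <= c k * x ^+ k.
  have [/codd ->|ek] := boolP (odd k); first by rewrite mul0r.
  rewrite -[k]odd_double_half (negPf ek) add0n ceven.
  by rewrite mulr_ge0 ?divr_ge0 ?mulr_ge0 ?exprn_even_ge0 ?odd_double.
have qx n x : (q n).[x] = \sum_(k < n) c k * x ^+ k.
  by rewrite horner_sum; apply: eq_bigr => k _; rewrite hornerZ hornerXn.
have q0 n x : 0 <= (q n).[x] by rewrite qx sumr_ge0.
have qlim x : (q n).[x] @[n --> \oo] --> expR (r * x) + expR (- (r * x)).
  have -> : (fun n => (q n).[x]) =
      (fun n => series (exp_coeff (r * x)) n + series (exp_coeff (- (r * x))) n).
    apply/funext => n; rewrite qx /series /= !big_mkord -big_split /=.
    by apply: eq_bigr => k _; rewrite !exp_coeffE /c -(mulNr r x) !exprMn; ring.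
  by apply: cvgD; exact: is_cvg_series_exp_coeff.
have intq n : (\int[mu]_(x in (setT : set mR)) (q n).[x]%:E <= (4 * M ^+ 2)%:E)%E.
  have -> : (\int[mu]_(x in (setT : set mR)) (q n).[x]%:E =
     (\int[mu]_(x in (setT : set mR)) (q n).[x])%:E)%E.
    by rewrite /Rintegral fineK// integrable_fin_num.
  rewrite lee_fin.
  apply: (@le_trans _ _ (\sum_(k < n) 2 * M ^+ 2 * 2^-1 ^+ k)); last first.
    rewrite -mulr_sumr (@le_trans _ _ (2 * M ^+ 2 * 2))//; last by lra.
    by rewrite ler_wpM2l ?half_sum// mulr_ge0// sqr_ge0.
  elim: n => [|n IH].
    rewrite big_ord0 /q; under eq_Rintegral do rewrite big_ord0 horner0.
    by rewrite Rintegral_cst// mul0r.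
  have -> : \int[mu]_(x in (setT : set mR)) (q n.+1).[x] =
     \int[mu]_(x in (setT : set mR)) (q n).[x] +
     \int[mu]_(x in (setT : set mR)) (c n *: 'X^n).[x].
    rewrite -RintegralD//; [|exact: ip..]; apply: eq_Rintegral => x _.
    by rewrite /q big_ord_recr hornerD.
  rewrite big_ord_recr /=; apply: lerD => //.
  have [/codd ->|en] := boolP (odd n).
    under eq_Rintegral do rewrite scale0r horner0.
    by rewrite Rintegral_cst// mul0r mulr_ge0 ?mulr_ge0 ?sqr_ge0.
  rewrite -[n]odd_double_half (negPf en) add0n; set m := n./2.
  have -> : \int[mu]_(x in (setT : set mR)) (c m.*2 *: 'X^(m.*2)).[x] =
     c m.*2 * \int[mu]_(x in (setT : set mR)) ('X^m ^+ 2).[x].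
    rewrite -RintegralZl//; last exact: ip.
    apply: eq_Rintegral => x _.
    by rewrite hornerZ -exprM muln2.
  have c0 : 0 <= c m.*2 by rewrite ceven divr_ge0// mulr_ge0// exprn_ge0// ltW.
  rewrite (le_trans (ler_wpM2l c0 (mb m)))// ceven.
  have fm : (m`!%:R * m`!%:R : R) <= (m.*2)`!%:R.
    rewrite -natrM ler_nat -addnn -(bin_fact (leq_addl m m)) addnK.
    by rewrite leq_pmull// bin_gt0 leq_addl.
  have f0 : 0 < ((m.*2)`!%:R : R) by rewrite ltr0n fact_gt0.
  have -> : 2 * r ^+ m.*2 / (m.*2)`!%:R * (M * m`!%:R * K ^+ m) ^+ 2 =
     2 * M ^+ 2 * (r * K) ^+ m.*2 * ((m`!%:R * m`!%:R) / (m.*2)`!%:R).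
    have K2 : K ^+ m.*2 = K ^+ m * K ^+ m by rewrite -addnn exprD.
    by rewrite [(r * K) ^+ _]exprMn K2; field; exact: lt0r_neq0.
  have -> : r * K = 2^-1 by rewrite /r; field; rewrite gt_eqF.
  rewrite ler_piMr ?mulr_ge0 ?sqr_ge0 ?exprn_ge0//.
  by rewrite ler_pdivrMr// mul1r.
have mq n : measurable_fun (setT : set mR) (fun x => (q n).[x]%:E).
  by apply/measurable_EFinP; exact: measurable_poly.
have qnd x : {homo (fun n => (q n).[x]%:E) : m n / (m <= n)%N >-> (m <= n)%E}.
  move=> m n mn; rewrite lee_fin.
  have : {homo (fun n => (q n).[x]) : m n / (m <= n)%N >-> m <= n}.
    by apply/nondecreasing_seqP => k; rewrite !qx big_ord_recr lerDl.
  exact.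
have h := cvg_monotone_convergence (mu := mu) measurableT mq
   (fun n x _ => q0 n x) (fun x _ => qnd x).
have qlimE : (fun x => limn (fun n => (q n).[x]%:E)) =
    (fun x => (expR (r * x) + expR (- (r * x)))%:E).
  apply/funext => x; apply/cvg_lim => //; apply/cvg_EFin; [near=> n|exact: qlim].
  by [].
rewrite qlimE in h.
have fin :
    (\int[mu]_(x in (setT : set mR)) (expR (r * x) + expR (- (r * x)))%:E <= (4 * M ^+ 2)%:E)%E.
  rewrite -(cvg_lim _ h)//; apply: lime_le.
    by apply/cvg_ex; eexists; exact: h.
  by near=> n; exact: intq.
have me (s : R) : measurable_fun (setT : set mR) (fun x : R => expR (s * x)).
  apply: measurableT_comp; first exact: measurable_expR.
  by apply: measurable_funM.
have iS : mu.-integrable (setT : set mR) (fun x => (expR (r * x) + expR (- (r * x)))%:E).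
  apply/integrableP; split.
    apply/measurable_EFinP; apply: measurable_funD; first exact: me.
    by under eq_fun do rewrite -mulNr; exact: me.
  under eq_integral do rewrite gee0_abs ?lee_fin ?addr_ge0 ?expR_ge0//.
  exact: le_lt_trans fin (ltry _).
apply: le_integrable iS => //.
  apply/measurable_EFinP; apply: measurableT_comp; first exact: measurable_expR.
  by apply: measurable_funM => //; exact: measurableT_comp.
move=> x _; rewrite !abse_EFin lee_fin ger0_norm ?expR_ge0// ger0_norm ?addr_ge0 ?expR_ge0//.
have [x0|x0] := leP 0 x; first by rewrite ger0_norm// lerDl expR_ge0.
by rewrite ltr0_norm// mulrN lerDr expR_ge0.
Unshelve. all: by end_near. Qed.

End Laplace.

(** * Moment functionals *)

Section PolynomialFunctional.
Variable R : realType.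
Local Notation C := R[i].
Local Notation RC := (real_complex R).

Lemma conjc_real (x : R) : conjc (x%:C) = x%:C.
Proof. by rewrite /= oppr0. Qed.

Lemma horner_conj (w : {poly C}) (x : R) :
  (map_poly (@conjc R) w).[x%:C] = conjc w.[x%:C].
Proof. by rewrite -{1}(conjc_real x) horner_map. Qed.

Lemma conj_real_poly (q : {poly R}) : map_poly (@conjc R) (map_poly RC q) = map_poly RC q.
Proof. by apply/polyP => i; rewrite !coef_map /= oppr0. Qed.

Lemma mul_conjc_ge0 (w : C) : complex.Re (w * conjc w) >= 0 /\ complex.Im (w * conjc w) = 0.
Proof.
case: w => a b /=; split; last by ring.
by rewrite mulrN opprK -!expr2 addr_ge0// sqr_ge0.
Qed.

Section Star.
Variables (P : nat -> {poly C}) (p : nat -> {poly R}) (tau : nat -> C).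
Hypothesis PE : forall n, P n = map_poly RC (n`!%:R *: p n).
Hypothesis sp : forall n, size (p n) = n.+1.

Lemma size_map_P n : size (P n) = n.+1.
Proof.
by rewrite PE size_map_poly size_scale ?sp// pnatr_eq0 -lt0n fact_gt0.
Qed.
Let sP := size_map_P.

Lemma conj_lfinE (f : lfin R) n : conj_lfin f n = conjc (f n).
Proof.
rewrite fsfun_fun; case: ifPn => // /eqP.
by rewrite memNfinsupp => /eqP/eqP ->; rewrite conjc_real.
Qed.

(** Real coefficients of the [P n] let conjugation commute with [IP P], so that [f] times its
    conjugate becomes a squared modulus on the real line. *)
Lemma IP_conj (f : lfin R) : IP P (conj_lfin f) = map_poly (@conjc R) (IP P f).
Proof.
have [N fN] := lfin_bounded f.
have f0 := fN N (leqnn N).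
have cf0 n : (N <= n)%N -> conj_lfin f n = 0 by move=> /f0 fn; rewrite conj_lfinE fn conjc_real.
rewrite /IP (lfin_sum _ cf0) (lfin_sum _ f0) rmorph_sum /=.
by apply: eq_bigr => n _; rewrite map_polyZ conj_lfinE PE conj_real_poly.
Qed.

Lemma dualE (f : lfin R) N : (forall n, (N <= n)%N -> f n = 0) ->
  dual tau f = \sum_(n < N) f n * tau n.
Proof.
move=> f0; have := lfin_sum (V := C^o) tau f0; rewrite /dual => <-.
by apply: eq_bigr => n _; rewrite mulrC.
Qed.

(** [tau] transported along the bijection [IP P] to a linear functional on polynomials, where [star]
    is ordinary multiplication. *)
Lemma dual_poly : exists T : {poly C} -> C,
  [/\ forall f, T (IP P f) = dual tau f,
      forall n, T (P n) = tau n &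
      forall a v w, T (v + a *: w) = T v + a * T w].
Proof.
have [J IPK JK] := IP_bij sP.
exists (fun w => dual tau (J w)); split.
- by move=> f; rewrite IPK.
- move=> n; rewrite -(IP_delta P) IPK (@dualE _ n.+1).
    rewrite big_ord_recr big1 /= ?add0r; last first.
      by move=> [m mn] _ /=; rewrite fsfun_fun !inE ltn_eqF// mul0r.
    by rewrite fsfun_fun !inE eqxx mul1r.
  by move=> m nm; rewrite fsfun_fun !inE gtn_eqF.
move=> a v w; set f := J v; set g := J w.
have [Nf fN] := lfin_bounded f; have [Ng gN] := lfin_bounded g.
pose N := maxn Nf Ng.
have f0 := fN N (leq_maxl _ _); have g0 := gN N (leq_maxr _ _).
pose h : lfin R := [fsfun n in [fset k in iota 0 N]%fset => f n + a * g n | 0].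
have hE n : h n = if (n < N)%N then f n + a * g n else 0.
  by rewrite fsfun_fun !inE mem_iota add0n.
have h0 n : (N <= n)%N -> h n = 0 by rewrite hE ltnNge => ->.
have -> : J (v + a *: w) = h.
  rewrite -[h]IPK /IP (lfin_sum _ h0); congr J.
  rewrite -[v]JK -[w]JK -/f -/g /IP (lfin_sum _ f0) (lfin_sum _ g0) scaler_sumr -big_split.
  by apply: eq_bigr => -[n nN] _ /=; rewrite hE nN scalerDl scalerA.
rewrite (dualE f0) (dualE g0) (dualE h0) mulr_sumr -big_split.
by apply: eq_bigr => -[n nN] _ /=; rewrite hE nN mulrDl mulrA.
Qed.

End Star.

(** * The seminorm of a positive functional *)

Section Functional.
Variable L : {poly R} -> R.
Hypothesis L_lin : forall p q (a : R), L (p + a *: q) = L p + a * L q.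
Hypothesis L_sqr : forall q, 0 <= L (q ^+ 2).

Definition L2norm q := Num.sqrt (L (q ^+ 2)).

Lemma L2normZ (c : R) q : L2norm (c *: q) = `|c| * L2norm q.
Proof. by rewrite /L2norm exprZn (functionalZ L_lin) sqrtrM ?sqr_ge0// sqrtr_sqr. Qed.

Lemma L2norm0 : L2norm 0 = 0.
Proof. by rewrite /L2norm expr0n /= (functional0 L_lin) sqrtr0. Qed.

Lemma functional_cauchy_schwarz q r : L (q * r) ^+ 2 <= L (q ^+ 2) * L (r ^+ 2).
Proof.
set A := L (q ^+ 2); set B := L (q * r); set D := L (r ^+ 2).
have A0 : 0 <= A by exact: L_sqr.
have h t : 0 <= A * t ^+ 2 + 2 * B * t + D.
  have := L_sqr (t *: q + r).
  have -> : (t *: q + r) ^+ 2 = r ^+ 2 + (2 * t) *: (q * r) + (t ^+ 2) *: q ^+ 2.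
    by rewrite -!mul_polyC !polyCM; ring.
  by rewrite !L_lin -/A -/B -/D => /le_trans; apply; lra.
have [A00|An0] := eqVneq A 0.
  have [->|B0] := eqVneq B 0; first by rewrite expr0n A00 mul0r.
  (* At this point the affine function [2 B t + D] would take the value -1. *)
  have := h (- (D + 1) / (2 * B)); rewrite A00 mul0r add0r.
  have -> : 2 * B * (- (D + 1) / (2 * B)) = - (D + 1) by field.
  by lra.
have Ap : 0 < A by rewrite lt0r An0.
have := h (- B / A).
have -> : A * (- B / A) ^+ 2 + 2 * B * (- B / A) + D = (A * D - B ^+ 2) / A by field.
by rewrite pmulr_lge0 ?invr_gt0// subr_ge0.
Qed.

Lemma L2normD q r : L2norm (q + r) <= L2norm q + L2norm r.
Proof.
rewrite /L2norm; have -> : (q + r) ^+ 2 = q ^+ 2 + 2 *: (q * r) + r ^+ 2.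
  by rewrite -mul_polyC; ring.
rewrite (functionalD L_lin) L_lin -[leRHS]ger0_norm ?addr_ge0 ?sqrtr_ge0// -sqrtr_sqr ler_wsqrtr//.
rewrite sqrrD !sqr_sqrtr// ?L_sqr// lerD2r lerD2l mulr_natl ler_wMn2r//.
rewrite -sqrtrM ?L_sqr// (le_trans (ler_norm _))// -sqrtr_sqr ler_wsqrtr//.
exact: functional_cauchy_schwarz.
Qed.

End Functional.
End PolynomialFunctional.

Section Main.
Variable R : realType.
Local Notation C := R[i].
Local Notation RC := (real_complex R).
Local Notation normc := ComplexField.Normc.normc.
Local Notation mR := (measurableTypeR R).

(** * Necessity: the moments of an analytic measure *)

Section Necessity.
Variables (P : nat -> {poly C}) (p : nat -> {poly R}) (tau : nat -> C).
Hypothesis PE : forall n, P n = map_poly RC (n`!%:R *: p n).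
Hypothesis sp : forall n, size (p n) = n.+1.

(** With [q = IP P f], the value of [tau] at the star product is the integral of [|q|^2]. *)
Lemma moment_star_positive : analytic_moment_functional P tau -> star_positive P tau.
Proof.
move=> [mu _ muP] f; set h := star P f (conj_lfin f).
have sP := size_map_P PE sp.
have hE : IP P h = IP P f * map_poly (@conjc R) (IP P f).
  by rewrite /h starE// (IP_conj PE).
have [_ iE] := cintegrable_sum (finsupp h) h (fun n => (muP n).1).
have -> : dual tau h = cintegral mu (fun x : R => (IP P h).[x%:C]).
  rewrite (_ : (fun x : R => (IP P h).[x%:C]) =
    (fun x : R => \sum_(n <- finsupp h) h n * (P n).[x%:C])); last first.
    by apply/funext => x; rewrite /IP horner_sum; apply: eq_bigr => n _; rewrite hornerZ.
  by rewrite iE; apply: eq_bigr => n _; rewrite (muP n).2 mulrC.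
rewrite hE lecE /cintegral /=.
have E (x : R) := mul_conjc_ge0 (IP P f).[x%:C].
under [X in X == _]eq_Rintegral do rewrite hornerM horner_conj (E _).2.
rewrite Rintegral_cst// mul0r eqxx /=; apply: Rintegral_ge0 => x _.
by rewrite hornerM horner_conj; have [] := E x.
Qed.

(** Taking the growth exponent equal to the exponent [r] of an exponential moment of [mu] gives
    [|tau n| <= const * n! * s^n]; the weight cancels [(n!)^2], and its factor [2^-(q n)] absorbs
    [s^(2n)]. *)
Lemma moment_l2minus :
  (forall e : R, 0 < e -> exists M s : R, [/\ 0 <= M, 0 < s &
     forall n x, `|(p n).[x]| <= M * s ^+ n * expR (e * `|x|)]) ->
  analytic_moment_functional P tau -> l2minus tau.
Proof.
move=> growth [mu /analytic_exp_integrable[r r0 ir] muP].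
have [M [s [M0 s0 pM]]] := growth r r0.
pose E := \int[mu]_(x in (setT : set mR)) expR (r * `|x|).
have E0 : 0 <= E by apply: Rintegral_ge0 => x _; exact: expR_ge0.
have f0 n : 0 < (n`!%:R : R) by rewrite ltr0n fact_gt0.
have tauM n : normc (tau n) <= n`!%:R * (2 * M * E) * s ^+ n.
  have [ci ->] := muP n.
  have -> : n`!%:R * (2 * M * E) * s ^+ n =
      2 * \int[mu]_(x in (setT : set mR)) (n`!%:R * (M * s ^+ n) * expR (r * `|x|)).
    by rewrite RintegralZl// -/E; ring.
  apply: normc_cintegral => //; first exact: exp_integrableZ.
  move=> x; rewrite PE horner_map /= hornerZ expr0n addr0 sqrtr_sqr normrM.
  by rewrite normr_nat -mulrA ler_wpM2l.
pose A := (2 * M * E) ^+ 2.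
have A0 : 0 <= A by exact: sqr_ge0.
(* Then [2^q >= q >= 2 s^2], so the terms decay at least like [2^-n]. *)
pose q := Num.bound (2 * s ^+ 2).
have sq : s ^+ 2 / 2 ^+ q <= 2^-1.
  rewrite ler_pdivrMr ?exprn_gt0// -ler_pdivrMl ?invr_gt0// invrK.
  rewrite (le_trans (ltW (archi_boundP _)))//; first by rewrite mulr_ge0// sqr_ge0.
  by rewrite -/q -natrX ler_nat ltnW// ltn_expl.
exists q.
have term n : normc (tau n) ^+ 2 * n`!%:R ^- 2 * 2 ^- (q * n) <= A * 2^-1 ^+ n.
  have n0 : 0 <= normc (tau n) by case: (tau n) => a b /=; rewrite sqrtr_ge0.
  rewrite exprM -[2 ^+ q ^- n]exprVn.
  apply: (@le_trans _ _ (A * (s ^+ 2 / 2 ^+ q) ^+ n)); last first.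
    rewrite ler_wpM2l// lerXn2r// ?nnegrE// ?invr_ge0//.
    by rewrite divr_ge0 ?sqr_ge0// exprn_ge0.
  rewrite exprMn mulrA ler_wpM2r ?exprn_ge0 ?invr_ge0 ?exprn_ge0//.
  rewrite ler_pdivrMr ?exprn_gt0//.
  have -> : A * (s ^+ 2) ^+ n * n`!%:R ^+ 2 = (n`!%:R * (2 * M * E) * s ^+ n) ^+ 2.
    by rewrite /A -exprM mulnC exprM; ring.
  by rewrite lerXn2r ?nnegrE// (le_trans n0).
have term0 n : (0 <= (normc (tau n) ^+ 2 * n`!%:R ^- 2 * 2 ^- (q * n))%:E)%E.
  rewrite lee_fin; apply: mulr_ge0; last by rewrite invr_ge0 exprn_ge0.
  by apply: mulr_ge0; rewrite ?invr_ge0 sqr_ge0.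
apply: (@le_lt_trans _ _ (A * 2)%:E); last exact: ltry.
apply: lime_le; first by apply: is_cvg_nneseries => n _ _; exact: term0.
near=> N; rewrite sumEFin lee_fin big_mkord.
apply: (@le_trans _ _ (\sum_(k < N) A * 2^-1 ^+ k)); first by apply: ler_sum => k _; exact: term.
by rewrite -mulr_sumr ler_wpM2l// half_sum.
Unshelve. all: by end_near. Qed.

End Necessity.

(** * Sufficiency: from positivity and growth to a measure *)

Section Sufficiency.
Variables (P : nat -> {poly C}) (p : nat -> {poly R}) (tau : nat -> C).
Hypothesis PE : forall n, P n = map_poly RC (n`!%:R *: p n).
Hypothesis sp : forall n, size (p n) = n.+1.
Hypothesis tau_pos : star_positive P tau.

(** Positivity makes [T] real and nonnegative on squares of real polynomials; the polarization
    [4 q = (q + 1)^2 - (q - 1)^2] then makes it real on all real polynomials. *)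
Lemma real_functional : exists L : {poly R} -> R,
  [/\ forall q r (a : R), L (q + a *: r) = L q + a * L r,
      forall q, 0 <= L (q ^+ 2),
      forall n, tau n = (n`!%:R * L (p n))%:C &
      forall n, dual tau (star P (delta R n) (delta R n)) = (n`!%:R ^+ 2 * L (p n ^+ 2))%:C].
Proof.
have sP := size_map_P PE sp.
have [T [TI TP T_lin]] := dual_poly tau PE sp.
have [J IPK JK] := IP_bij sP.
have T0 : T 0 = 0.
  by have := T_lin (-1) 0 0; rewrite scaler0 addr0 mulN1r subrr.
have TZ a v : T (a *: v) = a * T v by rewrite -[a *: v]add0r T_lin T0 add0r.
have Tsq q : complex.Im (T (map_poly RC q ^+ 2)) = 0 /\ 0 <= complex.Re (T (map_poly RC q ^+ 2)).
  set f := J (map_poly RC q).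
  have fE : IP P f = map_poly RC q by exact: JK.
  have := tau_pos f; rewrite -TI starE// (IP_conj PE) fE conj_real_poly -expr2.
  by rewrite lecE /= => /andP[/eqP -> ->].
have Tim q : complex.Im (T (map_poly RC q)) = 0.
  have -> : map_poly RC q = (4^-1)%:C *: (map_poly RC (q + 1) ^+ 2) +
       (- 4^-1)%:C *: map_poly RC (q - 1) ^+ 2.
    rewrite -!rmorphXn /= -!map_polyZ -rmorphD /=; congr map_poly.
    rewrite [LHS](_ : q = (4^-1 * 4) *: q); last by rewrite mulVf ?scale1r// pnatr_eq0.
    by rewrite -!mul_polyC polyCN polyCM polyC_natr; ring.
  rewrite T_lin TZ.
  have [h1 _] := Tsq (q + 1); have [h2 _] := Tsq (q - 1).
  by rewrite ![_%:C * _]mulrC raddfD /= !ImM_real h1 h2 !mul0r addr0.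
have Treal q : T (map_poly RC q) = (complex.Re (T (map_poly RC q)))%:C.
  by have := Tim q; case: (T _) => a b /= ->.
exists (fun q => complex.Re (T (map_poly RC q))).
have RZ (a : R) q : complex.Re (T (map_poly RC (a *: q))) = a * complex.Re (T (map_poly RC q)).
  by rewrite map_polyZ /= TZ mulrC ReM_real mulrC.
split.
- move=> q r a; rewrite rmorphD /= map_polyZ /= T_lin mulrC.
  by rewrite (Treal q) (Treal r) /=; ring.
- by move=> q; rewrite rmorphXn /=; have [] := Tsq q.
- by move=> n; rewrite -RZ -Treal -PE TP.
- move=> n; rewrite -TI starE// !(IP_delta P) -RZ -Treal; congr T.
  by rewrite PE -rmorphM /= -expr2 exprZn.
Qed.

(** The hypothesis on seminorms [N] abstracts the monomial bound for the family [p]; it is applied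
    to [L2norm L]. *)
Lemma growth_moment_functional (c : R) :
  (forall (N : {poly R} -> R) (M D : R),
    0 <= M -> N 0 = 0 -> (forall q r, N (q + r) <= N q + N r) ->
    (forall (a : R) q, N (a *: q) = `|a| * N q) ->
    (forall k, N (p k) <= M * D ^+ k) -> 0 <= D ->
    exists2 K : R, 0 <= K & forall n, N 'X^n <= M * n`!%:R * K ^+ n) ->
  0 < c ->
  (forall n, dual tau (star P (delta R n) (delta R n)) <= (n`!%:R ^+ 2 * c ^+ n.+1)%:C) ->
  analytic_moment_functional P tau.
Proof.
move=> monomial c0 taub.
have [L [L_lin L_sqr tauL dualL]] := real_functional.
have f0 n : 0 < (n`!%:R : R) by rewrite ltr0n fact_gt0.
have Lp n : L (p n ^+ 2) <= c ^+ n.+1.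
  by have := taub n; rewrite dualL lecR ler_pM2l// exprn_gt0.
have c1 := ltW c0.
have [K K0 hK] : exists2 K : R, 0 <= K &
    forall n, L2norm L 'X^n <= Num.sqrt c * n`!%:R * K ^+ n.
  (* The seminorm of [p n] is at most the power [n + 1] of [sqrt c], so both constants are
     [sqrt c]. *)
  apply: (monomial (L2norm L) (Num.sqrt c) (Num.sqrt c)); rewrite ?sqrtr_ge0//.
  - exact: L2norm0.
  - exact: L2normD.
  - exact: L2normZ.
  - move=> k; rewrite -exprS -[leRHS]ger0_norm ?exprn_ge0 ?sqrtr_ge0//.
    by rewrite -sqrtr_sqr ler_wsqrtr// exprAC sqr_sqrtr.
have [mu mom] := hamburger L_lin L_sqr.
have [r r0 ir] : exists2 r : R, 0 < r & exp_integrable mu r.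
  (* [K + 1] because [K] may be 0 while a positive constant is required. *)
  apply: (@moment_exp_integrable _ mu (Num.sqrt c) (K + 1)); rewrite ?sqrtr_ge0//.
  - by rewrite ltr_wpDl.
  - by move=> q; have [] := mom q.
  - move=> n; rewrite (mom _).2.
    have h := hK n; rewrite -[L _]sqr_sqrtr// lerXn2r ?nnegrE ?sqrtr_ge0//.
      by rewrite !mulr_ge0 ?sqrtr_ge0// exprn_ge0// addr_ge0.
    rewrite (le_trans h)// ler_wpM2l ?mulr_ge0 ?sqrtr_ge0//.
    by rewrite lerXn2r ?nnegrE ?addr_ge0// lerDl.
exists mu; first exact: exp_integrable_analytic ir.
move=> n.
have re (x : R) : complex.Re (P n).[x%:C] = (n`!%:R *: p n).[x] by rewrite PE horner_map.
have im (x : R) : complex.Im (P n).[x%:C] = 0 by rewrite PE horner_map.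
split.
- split.
  + under eq_fun do rewrite re; exact: (mom _).1.
  + by under eq_fun do rewrite im; exact: integrable0.
rewrite /cintegral tauL -(functionalZ L_lin) -(mom _).2; congr (_ +i* _).
- by apply: eq_Rintegral => x _; rewrite re.
- by under eq_Rintegral do rewrite im; rewrite Rintegral_cst// mul0r.
Qed.

End Sufficiency.
End Main.

Theorem theorem6p3 (R : realType) (P : nat -> {poly R[i]})
    (P_sheffer : sheffer P) (P_real : forall n : nat, real_valued (P n))
    (tau : nat -> R[i]) :
  (analytic_moment_functional P tau ->
     star_positive P tau /\ l2minus tau) /\
  (star_positive P tau ->
   (exists2 c : R, 0 < c &
      forall n : nat,
        dual tau (star P (delta R n) (delta R n)) <=
          (n`!%:R ^+ 2 * c ^+ n.+1)%:C) ->
   analytic_moment_functional P tau).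
Proof.
have [g [a [p [gB aB g0 a1 h]]]] := sheffer_real P_sheffer P_real.
have PE n : P n = map_poly (real_complex R) (n`!%:R *: p n) by have [] := h n.
have p0 n : (p n)`_0 = g n by have [] := h n.
have dp n : (p n)^`() = \sum_(j < n) a j.+1 *: p (n - j.+1)%N by have [] := h n.
have sp := sheffer_size g0 a1 p0 dp.
split.
  move=> tauM; split; first exact: (moment_star_positive PE sp tauM).
  by apply: (moment_l2minus PE _ tauM) => e e0; exact: (sheffer_growth gB aB p0 dp e0).
move=> tau_pos [c c0 taub].
apply: (growth_moment_functional PE sp tau_pos _ c0 taub) => N M D.
exact: (sheffer_monomial_bound gB aB g0 a1 p0 dp).
Qed.
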